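(* Let $\alpha>-1$ and $1<p,q<\infty$, with $q'=q/(q-1)$. Let $A$ be the spectral multiplier associated with a bounded non-negative sequence $(a_n)_{n\ge0}$, i.e. $A\ell_n^\alpha=a_n\ell_n^\alpha$ for all $n\in\mathbb N_0$. Assume that $A$ extends to a bounded linear operator from $L^p(\mu_\alpha)$ to $L^q(\mu_\alpha)$. For $\tau>0$ let $g_\tau(x)=e^{\tau x}$, $x>0$. Then for all $\tau_1\in(0,1/p)$ and $\tau_2\in(0,1/q')$, $$\langle Ag_{\tau_1},g_{\tau_2}\rangle_{\mu_\alpha}=(1-\tau_1)^{-(\alpha+1)}(1-\tau_2)^{-(\alpha+1)}\bigg(a_0+\sum_{n=1}^\infty a_n\frac{\Gamma(n+\alpha+1)}{\Gamma(\alpha+1)\,n!}\,\varrho(\tau_1,\tau_2)^n\bigg)<\infty,$$ where $$\varrho(\tau_1,\tau_2):=\frac{\tau_1\tau_2}{(1-\tau_1)(1-\tau_2)}\ge0.$$ Consequently, $$\limsup_{n\to\infty}a_n^{1/n}\le\frac{p-1}{q-1}.$$ Moreover, there exists a constant $C_{\alpha,p,q}>0$ (depending only on $\alpha,p,q$) such that for every $n\in\mathbb N_0$, $$a_n\le C_{\alpha,p,q}\,\|A\|_{p\to q}\Big(\frac{p-1}{q-1}\Big)^n(n+1)^{(\alpha+1)(p^{-1}-q^{-1})+1}.$$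
   Context: $d\mu_\alpha(x)=\Gamma(\alpha+1)^{-1}x^\alpha e^{-x}dx$ is the normalized Gamma probability measure on $(0,\infty)$. The Laguerre polynomials $L_n^\alpha$ are defined by $\sum_{n\ge0}L_n^\alpha(x)r^n=(1-r)^{-\alpha-1}\exp(-\frac{r}{1-r}x)$, $|r|<1$, and $\ell_n^\alpha=\big(\frac{n!\,\Gamma(\alpha+1)}{\Gamma(n+\alpha+1)}\big)^{1/2}L_n^\alpha$ are their $L^2(\mu_\alpha)$-normalized versions, an orthonormal basis of $L^2(\mu_\alpha)$. The multiplier $A$ is first defined on $L^2(\mu_\alpha)$ (in particular on polynomials, which are dense in $L^r(\mu_\alpha)$ for $1\le r<\infty$); $Ag_{\tau_1}$ denotes the value of the $L^p\to L^q$ extension. $\langle g,h\rangle_{\mu_\alpha}=\int gh\,d\mu_\alpha$, and $\|A\|_{p\to q}$ is the operator norm from $L^p(\mu_\alpha)$ to $L^q(\mu_\alpha)$. *)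

(* Defs.v *)
From HB Require Import structures.
From mathcomp Require Import all_boot all_order all_algebra.
From mathcomp Require Import all_classical all_reals all_analysis.
From mathcomp Require Import measurable_realfun.

Set Implicit Arguments.
Unset Strict Implicit.
Unset Printing Implicit Defensive.

Import Order.TTheory GRing.Theory Num.Theory.
Import numFieldNormedType.Exports.

Local Open Scope classical_set_scope.
Local Open Scope ring_scope.

Definition Gamma {R : realType} (s : R) : R :=
  \int[lebesgue_measure]_(t in `]0, +oo[) (t `^ (s - 1) * expR (- t)).

Lemma Gamma_ge0 {R : realType} (s : R) : 0 <= Gamma s.
Proof.
by apply: Rintegral_ge0 => t _; rewrite mulr_ge0 ?powR_ge0 ?expR_ge0.
Qed.

Definition gamma_pdf {R : realType} (alpha : R) : R -> R :=
  (fun x => (Gamma (alpha + 1))^-1 * x `^ alpha * expR (- x)) \_ `]0, +oo[.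

(* mu_alpha, as a measure on R carried by ]0, +oo[ *)
Definition gamma_measure {R : realType} (alpha : R) : set _ -> \bar R :=
  fun V => (\int[lebesgue_measure]_(x in V) (gamma_pdf alpha x)%:E)%E.

Section gamma_measure.
Context {R : realType} (alpha : R).

Lemma gamma_pdf_ge0 x : 0 <= gamma_pdf alpha x.
Proof.
apply: restrict_ge0 => {}x _.
by rewrite !mulr_ge0 ?expR_ge0 ?powR_ge0// invr_ge0 Gamma_ge0.
Qed.

Lemma measurable_gamma_pdf : measurable_fun [set: R] (gamma_pdf alpha).
Proof.
apply/measurable_restrict => //; apply: measurable_funTS.
apply: measurable_funM; last exact: measurableT_comp.
by apply: measurable_funM => //; exact: measurable_powR.
Qed.

Let gamma_measure0 : gamma_measure alpha set0 = 0%E.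
Proof. by rewrite /gamma_measure integral_set0. Qed.

Let gamma_measure_ge0 A : (0 <= gamma_measure alpha A)%E.
Proof. by apply: integral_ge0 => x _; rewrite lee_fin gamma_pdf_ge0. Qed.

Let gamma_measure_sigma_additive : semi_sigma_additive (gamma_measure alpha).
Proof.
move=> /= A mA tA mUA.
rewrite /gamma_measure/= ge0_integral_bigcup//=.
- apply: is_cvg_ereal_nneg_natsum_cond => n _ _.
  by apply: integral_ge0 => /= x _; rewrite lee_fin gamma_pdf_ge0.
- apply: measurable_funTS; apply/measurable_EFinP.
  exact: measurable_gamma_pdf.
- by move=> x _; rewrite lee_fin gamma_pdf_ge0.
Qed.

HB.instance Definition _ := isMeasure.Build _ _ _
  (gamma_measure alpha) gamma_measure0 gamma_measure_ge0
  gamma_measure_sigma_additive.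

End gamma_measure.

Definition is_laguerre {R : realType} (alpha : R) (L : nat -> {poly R}) :=
  forall x r : R, `|r| < 1 ->
    series (fun n => (L n).[x] * r ^+ n) @ \oo -->
      (1 - r) `^ (- alpha - 1) * expR (- (r / (1 - r)) * x).

Definition laguerre_normalized {R : realType} (alpha : R)
    (L : nat -> {poly R}) (n : nat) (x : R) : R :=
  Num.sqrt (n`!%:R * Gamma (alpha + 1) / Gamma (n%:R + alpha + 1)) * (L n).[x].

Section operators.
Context d (X : measurableType d) (R : realType).
Variables (mu : {measure set X -> \bar R}) (p q : R).

(* The library's L^p space has no module structure: operators are maps on
   representatives, well defined and linear up to almost-everywhere equality;
   nothing is required of [T f] when [f] is not in L^p. *)
Record bounded_operator (T : (X -> R) -> X -> R) : Prop := BoundedOperator {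
  operator_Lfun : forall f, f \in Lfun mu p%:E -> T f \in Lfun mu q%:E ;
  operator_ae : forall f g, f \in Lfun mu p%:E -> g \in Lfun mu p%:E ->
    f = g %[ae mu] -> T f = T g %[ae mu] ;
  operator_linear : forall (c : R) f g,
    f \in Lfun mu p%:E -> g \in Lfun mu p%:E ->
    T (fun x => c * f x + g x) = (fun x => c * T f x + T g x) %[ae mu] ;
  operator_bounded : exists M : R, forall f, f \in Lfun mu p%:E ->
    ('N[mu]_q%:E[EFin \o T f] <= M%:E * 'N[mu]_p%:E[EFin \o f])%E
}.

Definition operator_norm (T : (X -> R) -> X -> R) : \bar R :=
  ereal_sup [set 'N[mu]_q%:E[EFin \o T f]%E | f in
    [set f | f \in Lfun mu p%:E /\ ('N[mu]_p%:E[EFin \o f] <= 1)%E]].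

End operators.

(* A is a bounded operator on L^2(mu_alpha), hence determined by its values on
   the orthonormal basis. *)
Definition spectral_multiplier {R : realType} (alpha : R) (L : nat -> {poly R})
    (a : nat -> R) (A : (R -> R) -> R -> R) : Prop :=
  bounded_operator (gamma_measure alpha) 2 2 A /\
  forall n, A (laguerre_normalized alpha L n) =
    (fun x => a n * laguerre_normalized alpha L n x) %[ae gamma_measure alpha].

(* The operator T agrees with the L^2-operator A on the intersection of
   L^2 and L^p; this pins T down, since the intersection is dense in L^p. *)
Definition extends_to_Lp {R : realType} (alpha p : R)
    (A T : (R -> R) -> R -> R) : Prop :=
  forall f : R -> R,
    f \in Lfun (gamma_measure alpha) 2%:E ->
    f \in Lfun (gamma_measure alpha) p%:E ->
    T f = A f %[ae gamma_measure alpha].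

Definition exp_fun {R : realType} (tau x : R) : R := expR (tau * x).

Definition varrho {R : realType} (tau1 tau2 : R) : R :=
  tau1 * tau2 / ((1 - tau1) * (1 - tau2)).

(* Main.v *)
From HB Require Import structures.
Require Import Defs.
From mathcomp Require Import all_boot all_order all_algebra.
From mathcomp Require Import all_classical all_reals all_analysis.
From mathcomp Require Import measurable_realfun ring lra.

(* Put s = alpha + 1, g_tau(x) = e^(tau x). Expanding the generating function at
   x <= 0, where all terms are nonnegative, identifies L_n explicitly, and
   binomial inversion writes x^j in terms of L_0, ..., L_j with coefficients of
   sign (-1)^n; the integral of L_n g_tau also has the sign (-1)^n. Hence, for
   the Taylor polynomial P_J of g_tau1, the pairing <A P_J, g_tau2> is a finite
   sum of nonnegative terms that increase with J. Since
   0 <= g_tau1 - P_J <= (tau1 / tau)^J g_tau on x > 0 for tau1 < tau < 1/p, the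
   polynomials P_J converge to g_tau1 in L^p, and the termwise limit gives the
   formula.
   The bound on a_n keeps a single term of the series, estimates the pairing by
   Hoelder, and takes p tau1 = q' tau2 = 1 - 1 / (n + 2). *)

Set Implicit Arguments.
Unset Strict Implicit.
Unset Printing Implicit Defensive.

Import Order.TTheory GRing.Theory Num.Theory.
Import numFieldNormedType.Exports.

Local Open Scope classical_set_scope.
Local Open Scope ring_scope.

(** The generating function gives [e^(tau x)] as [(1 - tau)^(-s)] times the sum of
    [L_n(x) (-tau / (1 - tau))^n], but only for [tau < 1/2], which is also the condition for [g_tau]
    to be in L^2. If p < 2, then [tau1] may lie in [1/2, 1/p), where [g_tau1] is outside the domain
    on which the multiplier is diagonal. This is why the operator is evaluated on polynomials only
    and why the limit is taken in L^p. The signs matter because every exchange of sums, integrals or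
    limits of series then concerns nonnegative terms, so that no absolute convergence has to be
    proved separately. At the critical values p tau1 = q' tau2 = 1 the ratio [varrho] equals (q -
    1)/(p - 1), the inverse of the ratio in the bound on a_n. The Hoelder norms blow up there, so
    the critical point is approached at a distance depending on n: with 1/(n + 2) the loss in
    [varrho ^+ n] is a bounded factor and the norms grow only polynomially. The limsup is then read
    off the bound on a_n. *)

(** * The Gamma integral: scaling, finiteness, positivity, functional equation *)

Section gamma_function.
Context {R : realType}.
Implicit Types s c x : R.
Local Notation leb := (@lebesgue_measure R).

Lemma measurable_gamma_kernel (D : set R) s c : measurable_fun D
  (fun t : R => t `^ (s - 1) * expR (- (c * t))).
Proof.
apply: measurable_funTS; apply: measurable_funM; first exact: measurable_powR.
by apply: measurableT_comp => //; apply: measurableT_comp.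
Qed.

Lemma gamma_kernel_ge0 s c t : 0 <= t `^ (s - 1) * expR (- (c * t)).
Proof. by rewrite mulr_ge0 ?powR_ge0 ?expR_ge0. Qed.

Lemma bigcup_itvcy_gt0 c : 0 < c ->
  \bigcup_(i in [set: nat]) [set` `[c * i.+1%:R^-1, +oo[] = [set` `]0%R, +oo[].
Proof.
move=> c0; apply/seteqP; split => x /=.
  move=> [i _] /=; rewrite !in_itv/= !andbT; apply: lt_le_trans.
  by rewrite mulr_gt0.
rewrite in_itv/= andbT => x0; exists (Num.truncn (c / x)) => //=.
rewrite in_itv/= andbT ler_pdivrMr// mulrC -ler_pdivrMr//.
exact/ltW/truncnS_gt.
Qed.

(** For s < 1 the Gamma kernel is singular at 0, so substitution and the fundamental theorem of
    calculus are applied on closed half-lines, and this limit recovers ]0, +oo[. The factor [c]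
    makes the half-lines match under t -> c t. *)
Lemma ge0_cvg_integral_itvcy c (f : R -> R) : 0 < c ->
  measurable_fun [set: R] f -> (forall x, 0 <= f x) ->
  (\int[leb]_(x in `[(c * i.+1%:R^-1)%R, +oo[) (f x)%:E)%E @[i --> \oo] -->
  (\int[leb]_(x in `]0%R, +oo[) (f x)%:E)%E.
Proof.
move=> c0 mf f0; rewrite -(bigcup_itvcy_gt0 c0).
apply: ge0_nondecreasing_set_cvg_integral => //.
- move=> m n mn; apply/subsetPset => x /=; rewrite !in_itv/= !andbT.
  by apply: le_trans; rewrite ler_pM2l// lef_pV2 ?posrE// ler_nat.
- by move=> i; apply/measurable_EFinP; exact: measurable_funTS.
- by move=> i x _; rewrite lee_fin.
Qed.

Lemma continuous_powR_gt0 s x : 0 < x -> {for x, continuous (fun t : R => t `^ s)}.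
Proof.
move=> x0; have [+ _] := is_derive1_powR s x0.
by move/derivable1_diffP/differentiable_continuous.
Qed.

Lemma continuous_gamma_kernel s c x : 0 < x ->
  {for x, continuous (fun t : R => t `^ (s - 1) * expR (- (c * t)))}.
Proof.
move=> x0; apply: cvgM; first exact: continuous_powR_gt0.
apply: continuous_comp; last exact: continuous_expR.
by apply: cvgN; apply: cvgM => //; exact: cvg_cst.
Qed.

Lemma within_continuous_itvcy (f : R -> R) a : 0 < a ->
  (forall x, 0 < x -> {for x, continuous f}) -> {within `[a, +oo[, continuous f}.
Proof.
move=> a0 cf; apply/continuous_within_itvcyP; split.
  by move=> x; rewrite in_itv/= andbT => ax; apply: cf; exact: lt_trans ax.
by apply: cvg_at_right_filter; exact: cf.
Qed.

Lemma gamma_scaling_itvcy s c a : 0 < c -> 0 < a ->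
  (\int[leb]_(t in `[(c * a)%R, +oo[) (t `^ (s - 1) * expR (- (1 * t)))%:E =
   (c `^ s)%:E * \int[leb]_(t in `[a, +oo[) (t `^ (s - 1) * expR (- (c * t)))%:E)%E.
Proof.
move=> c0 a0.
have dF : (fun t : R => c * t)^`()%classic = cst c :> (R -> R).
  apply/funext => x; rewrite derive1E.
  apply: derive_val.
  have : is_derive x 1 (fun t : R => c * t) (c *: 1) by exact: is_deriveZ.
  by rewrite /GRing.scale/= mulr1.
rewrite (increasing_ge0_integration_by_substitutiony (F := fun t => c * t)) => //.
- rewrite -ge0_integralZl//=.
  + rewrite dF; apply: eq_integral => t /[!inE]/= /[!in_itv]/= /andP[at_ _].
    have t0 : 0 < t by exact: lt_le_trans at_.
    rewrite -EFinM; congr EFin.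
    change ((c * t) `^ (s - 1) * expR (- (1 * (c * t))) * c =
            c `^ s * (t `^ (s - 1) * expR (- (c * t)))).
    rewrite mul1r powRM ?ltW//.
    have -> : c `^ s = c `^ (s - 1) * c.
      rewrite -{3}(powRr1 (ltW c0)) -powRD ?subrK//.
      by apply/implyP => _; rewrite gt_eqF.
    by ring.
  + by apply/measurable_EFinP; exact: measurable_gamma_kernel.
  + by move=> t _; rewrite lee_fin gamma_kernel_ge0.
  + by rewrite lee_fin powR_ge0.
- by move=> x y _ _ xy; rewrite ltr_pM2l.
- by rewrite dF => x _; exact: cst_continuous.
- by rewrite dF; exact: is_cvg_cst.
- by rewrite dF; exact: is_cvg_cst.
- split.
    by move=> x _; exact: derivableM.
  by apply: cvg_at_right_filter; apply: cvgM => //; exact: cvg_cst.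
- exact: gt0_cvgMry.
- apply: within_continuous_itvcy; first exact: mulr_gt0.
  by move=> x; exact: continuous_gamma_kernel.
- by move=> x _; exact: gamma_kernel_ge0.
Qed.

Lemma integral_gamma_kernelZ s c : 0 < c ->
  (\int[leb]_(t in `]0%R, +oo[) (t `^ (s - 1) * expR (- (c * t)))%:E =
   (c `^ (- s))%:E *
   \int[leb]_(t in `]0%R, +oo[) (t `^ (s - 1) * expR (- (1 * t)))%:E)%E.
Proof.
move=> c0.
have H : (\int[leb]_(t in `]0%R, +oo[) (t `^ (s - 1) * expR (- (1 * t)))%:E =
   (c `^ s)%:E *
   \int[leb]_(t in `]0%R, +oo[) (t `^ (s - 1) * expR (- (c * t)))%:E)%E.
  have cu := ge0_cvg_integral_itvcy ltr01 (@measurable_gamma_kernel setT s c)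
    (gamma_kernel_ge0 s c).
  have cv := ge0_cvg_integral_itvcy c0 (@measurable_gamma_kernel setT s 1)
    (gamma_kernel_ge0 s 1).
  apply: (cvg_unique _ cv) => //.
  have -> : (fun i : nat => \int[leb]_(x in `[(c * i.+1%:R^-1)%R, +oo[)
      (x `^ (s - 1) * expR (- (1 * x)))%:E)%E =
    (fun i : nat => (c `^ s)%:E * \int[leb]_(x in `[(1 * i.+1%:R^-1)%R, +oo[)
      (x `^ (s - 1) * expR (- (c * x)))%:E)%E.
    by apply/funext => i; rewrite gamma_scaling_itvcy// mul1r.
  exact: cvgeZl.
rewrite H muleA -EFinM powRN mulVf ?mul1e//.
by rewrite gt_eqF// powR_gt0.
Qed.

Lemma powR_cvgy s : 0 < s -> t `^ s @[t --> +oo] --> +oo.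
Proof.
move=> s0; apply/cvgryPge => A; near=> t.
have A0 : 0 <= Num.max A 0 by rewrite le_max lexx orbT.
apply: (@le_trans _ _ (Num.max A 0)); first by rewrite le_max lexx.
have -> : Num.max A 0 = (Num.max A 0 `^ s^-1) `^ s.
  by rewrite -powRrM mulVf ?gt_eqF// powRr1.
have tA : Num.max A 0 `^ s^-1 <= t by near: t; exact: nbhs_pinfty_ge.
apply: ge0_ler_powR => //; rewrite ?nnegrE ?powR_ge0 ?ltW//.
Unshelve. all: by end_near. Qed.

Lemma sqr_powRD1_le s : 0 < s -> exists2 K : R, 0 < K &
  forall t, 0 < t -> (1 + t `^ s) ^+ 2 <= K * expR t.
Proof.
move=> s0; pose k := (Num.truncn s).+1.
(* With u = t^k: t^s <= 1 + u because k > s, then (2 + u)^2 <= 8 + 2 u^2, and u^2 <= (2k)! e^t by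
   the exponential series. *)
exists (8 + 2 * (k + k)`!%:R).
  by rewrite ltr_pwDl// mulr_ge0.
move=> t t0.
have e1 : 1 <= expR t by rewrite -expR0 ler_expR ltW.
have tk : t `^ s <= 1 + t ^+ k.
  have [t1|t1] := leP t 1.
    rewrite (@le_trans _ _ 1)//; last by rewrite lerDl exprn_ge0// ltW.
    by rewrite -[leRHS](powRr0 t) ger_powR ?t0//  ltW.
  rewrite (@le_trans _ _ (t ^+ k))//; last by rewrite lerDr.
  have -> : t ^+ k = t `^ k%:R by rewrite powR_mulrn// ltW.
  by apply: ler_powR; apply: ltW => //; exact: truncnS_gt.
have te : t ^+ (k + k) <= (k + k)`!%:R * expR t.
  rewrite mulrC -ler_pdivrMr ?ltr0n ?fact_gt0//.
  have := expR_ge1Dxn (k + (Num.truncn s)) (ltW t0).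
  by rewrite -addnS -/k; lra.
have tk0 : 0 <= t ^+ k by rewrite exprn_ge0// ltW.
have ts0 : 0 <= t `^ s by exact: powR_ge0.
move: te; rewrite exprD => te.
have h1 : (1 + t `^ s) ^+ 2 <= (2 + t ^+ k) ^+ 2.
  by rewrite ler_sqr ?nnegrE; lra.
have h2 := sqr_ge0 (t ^+ k - 2).
rewrite (le_trans h1)//; move: h2; rewrite !expr2; lra.
Qed.

Lemma is_derive_invD1powR s x : 0 < x ->
  is_derive x 1 (fun t : R => - (1 + t `^ s)^-1)
    (s * x `^ (s - 1) / (1 + x `^ s) ^+ 2).
Proof.
move=> x0; have n0 : 1 + x `^ s != 0 by rewrite gt_eqF// ltr_pwDl// powR_ge0.
have d1 := is_derive1_powR s x0.
have d2 : is_derive x 1 (fun t : R => 1 + t `^ s) (s * x `^ (s - 1)).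
  by rewrite -[s * _]add0r; exact: is_deriveD.
have d3 := is_deriveV (f := fun t : R => 1 + t `^ s) n0 d2.
have := is_deriveN d3.
by rewrite /GRing.scale/= mulNr opprK mulrC.
Qed.

(** The kernel is at most K/s times the derivative of -(1 + t^s)^-1, whose total increase is at most
    1. This single primitive controls both the singularity at 0 and the tail; the comparison amounts
    to (1 + t^s)^2 <= K e^t. *)
Lemma integral_gamma_kernel_lty s : 0 < s ->
  (\int[leb]_(t in `]0%R, +oo[) (t `^ (s - 1) * expR (- (1 * t)))%:E < +oo)%E.
Proof.
move=> s0; have [K K0 HK] := sqr_powRD1_le s0.
pose f := (fun t : R => s * t `^ (s - 1) / (1 + t `^ s) ^+ 2).
have f0 t : 0 <= f t.
  by rewrite /f divr_ge0 ?mulr_ge0 ?powR_ge0 ?exprn_ge0 ?addr_ge0 ?powR_ge0// ltW.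
have cf x : 0 < x -> {for x, continuous f}.
  move=> x0; apply: cvgM.
    by apply: cvgM; [exact: cvg_cst|exact: continuous_powR_gt0].
  apply: cvgV; first by rewrite expf_neq0// gt_eqF// ltr_pwDl// powR_ge0.
  apply: (@continuous_comp _ _ _ (fun t : R => 1 + t `^ s) (fun y : R => y ^+ 2));
    last exact: exprn_continuous.
  by apply: cvgD; [exact: cvg_cst|exact: continuous_powR_gt0].
have bound a : 0 < a -> (\int[leb]_(t in `[a, +oo[)
    (t `^ (s - 1) * expR (- (1 * t)))%:E <= (K / s)%:E)%E.
  move=> a0.
  have : (\int[leb]_(t in `[a, +oo[) (f t)%:E <= 1)%E.
    rewrite (ge0_continuous_FTC2y (F := fun t => - (1 + t `^ s)^-1) (l := 0)) //.
    - rewrite -EFinB lee_fin opprK add0r invf_le1 ?lerDl ?powR_ge0//.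
      by rewrite ltr_pwDl// powR_ge0.
    - exact: within_continuous_itvcy.
    - rewrite -oppr0; apply: cvgN; apply/gtr0_cvgV0.
        by near=> t; rewrite ltr_pwDl// powR_ge0.
      apply/cvgryPge => A; have /cvgryPge/(_ A) := powR_cvgy s0.
      by apply: filterS => t; lra.
    - by move=> x ax; have [] := is_derive_invD1powR s (lt_trans a0 ax).
    - apply: cvg_at_right_filter.
      have [+ _] := is_derive_invD1powR s a0.
      by move/derivable1_diffP/differentiable_continuous.
    - move=> x; rewrite in_itv/= andbT => ax; rewrite derive1E.
      exact: (@derive_val _ _ _ _ _ _ _ (is_derive_invD1powR s (lt_trans a0 ax))).
  move=> I1; rewrite -[leRHS]mule1.
  have KE : (0 <= (K / s)%:E)%E by rewrite lee_fin divr_ge0// ltW.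
  apply: (le_trans _ (lee_wpmul2l KE I1)).
  have mf : measurable_fun `[a, +oo[ f.
    apply: subspace_continuous_measurable_fun => //.
    exact: within_continuous_itvcy.
  rewrite -ge0_integralZl//=; last 2 first.
  - by apply/measurable_EFinP.
  - by move=> t _; rewrite lee_fin.
  apply: ge0_le_integral => //=.
  - by move=> t _; rewrite lee_fin gamma_kernel_ge0.
  - by apply/measurable_EFinP; exact: measurable_gamma_kernel.
  - by apply/measurable_EFinP; exact: measurable_funM.
  move=> t; rewrite in_itv/= andbT => at_.
  have t0 : 0 < t by exact: lt_le_trans at_.
  have D1 : 0 < 1 + t `^ s by rewrite ltr_pwDl// powR_ge0.
  have D0 : 0 < (1 + t `^ s) ^+ 2 by rewrite exprn_gt0.
  rewrite -EFinM lee_fin mul1r.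
  have -> : K / s * f t = t `^ (s - 1) * (K / (1 + t `^ s) ^+ 2).
    by rewrite /f; field; rewrite !gt_eqF.
  rewrite ler_wpM2l ?powR_ge0// expRN ler_pdivlMr// mulrC ler_pdivrMr ?expR_gt0//.
  exact: HK.
have := ge0_cvg_integral_itvcy ltr01 (@measurable_gamma_kernel setT s 1)
    (gamma_kernel_ge0 s 1).
move/(cvge_le _) => /(_ (K / s)%:E) H.
apply: le_lt_trans (ltry (K / s)); apply: H.
by near=> n; apply: bound; rewrite mul1r invr_gt0.
Unshelve. all: by end_near. Qed.

Lemma EFin_Gamma s : 0 < s ->
  (\int[leb]_(t in `]0%R, +oo[) (t `^ (s - 1) * expR (- (1 * t)))%:E = (Gamma s)%:E)%E.
Proof.
move=> s0; rewrite /Gamma /Rintegral.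
have -> : (\int[leb]_(t in `]0%R, +oo[) (t `^ (s - 1) * expR (- t))%:E =
    \int[leb]_(t in `]0%R, +oo[) (t `^ (s - 1) * expR (- (1 * t)))%:E)%E.
  by apply: eq_integral => t _; rewrite mul1r.
rewrite fineK// ge0_fin_numE; first exact: integral_gamma_kernel_lty.
by apply: integral_ge0 => t _; rewrite lee_fin gamma_kernel_ge0.
Qed.

Lemma integral_gamma_kernel s c : 0 < s -> 0 < c ->
  (\int[leb]_(t in `]0%R, +oo[) (t `^ (s - 1) * expR (- (c * t)))%:E =
   (c `^ (- s) * Gamma s)%:E)%E.
Proof. by move=> s0 c0; rewrite integral_gamma_kernelZ// EFin_Gamma. Qed.

(** A zero integral would make the kernel vanish almost everywhere, yet it is positive on ]0, 1], a
    set of measure 1. *)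
Lemma Gamma_gt0 s : 0 < s -> 0 < Gamma s.
Proof.
move=> s0; rewrite lt_neqAle Gamma_ge0 andbT eq_sym; apply/eqP => G0.
have : (\int[leb]_(t in `]0%R, +oo[) `|(t `^ (s - 1) * expR (- (1 * t)))%:E| = 0)%E.
  under eq_integral do rewrite gee0_abs ?lee_fin ?gamma_kernel_ge0//.
  by rewrite EFin_Gamma// G0.
have mg : measurable_fun (`]0, +oo[ : set R) (fun t : R => (t `^ (s - 1) * expR (- (1 * t)))%:E).
  by apply/measurable_EFinP; exact: measurable_gamma_kernel.
move/(proj1 (ae_eq_integral_abs leb (measurable_itv _) mg)).
rewrite /ae_eq => H.
have : leb.-negligible (`]0, 1] : set R).
  apply: (negligibleS _ H) => t /=; rewrite in_itv/= => /andP[t0 t1].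
  move=> K; have /K[/eqP] : t \in `]0%R, +oo[ by rewrite in_itv/= t0.
  by rewrite mulf_eq0 powR_eq0 expR_eq0 gt_eqF.
rewrite negligibleP; last exact: measurable_itv.
rewrite /= lebesgue_measure_itv/= lte_fin ltr01.
by rewrite sube0 => -[/eqP]; rewrite oner_eq0.
Qed.

(** A variational argument replaces integration by parts. The function [f c] is the integral of
    t^(s-1) (e^(-c t) + c t e^(-t)), and e^(-(c-1) t) >= 1 - (c-1) t makes it minimal at c = 1, so
    its derivative there, Gamma (s + 1) - s Gamma s, vanishes. *)
Lemma GammaS s : 0 < s -> Gamma (s + 1) = s * Gamma s.
Proof.
move=> s0.
pose f (c : R) := c `^ (- s) * Gamma s + c * Gamma (s + 1).
have s1 : 0 < s + 1 by rewrite addr_gt0.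
have f_min c : 0 < c -> f 1 <= f c.
  move=> c0; rewrite /f powR1/= !mul1r -lee_fin.
  pose k (s' c' t : R) := t `^ (s' - 1) * expR (- (c' * t)).
  have mk s' c' : measurable_fun (`]0, +oo[ : set R) (fun t => (k s' c' t)%:E).
    by apply/measurable_EFinP; exact: measurable_gamma_kernel.
  have k0 s' c' (t : R) : (0 <= (k s' c' t)%:E)%E.
    by rewrite lee_fin gamma_kernel_ge0.
  have c0' : (0 <= c%:E)%E by rewrite lee_fin ltW.
  have -> : (Gamma s + Gamma (s + 1))%:E =
      (\int[leb]_(t in `]0%R, +oo[) ((k s 1 t)%:E + (k (s + 1) 1 t)%:E))%E.
    rewrite ge0_integralD//; [|exact: mk..].
    by rewrite EFinD -(EFin_Gamma s0) -(EFin_Gamma s1).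
  have -> : (c `^ (- s) * Gamma s + c * Gamma (s + 1))%:E =
      (\int[leb]_(t in `]0%R, +oo[) ((k s c t)%:E + c%:E * (k (s + 1) 1 t)%:E))%E.
    rewrite ge0_integralD//; last 3 first.
    - exact: mk.
    - by move=> t _; rewrite mule_ge0.
    - by apply: emeasurable_funM => //; exact: mk.
    rewrite ge0_integralZl//; last exact: mk.
    by rewrite EFinD -(integral_gamma_kernel s0 c0) EFinM -(EFin_Gamma s1).
  apply: ge0_le_integral => //=.
  - by move=> t _; rewrite adde_ge0.
  - by apply: emeasurable_funD; exact: mk.
  - apply: emeasurable_funD; first exact: mk.
    by apply: emeasurable_funM => //; exact: mk.
  move=> t; rewrite in_itv/= andbT => t0.
  rewrite -EFinM -!EFinD lee_fin /k.
  have -> : t `^ (s + 1 - 1) = t `^ (s - 1) * t.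
    by rewrite addrK mulrC mulr_powRB1// ltW.
  have -> : expR (- (c * t)) = expR (- (1 * t)) * expR (- ((c - 1) * t)).
    by rewrite -expRD; congr expR; ring.
  set u := t `^ _; set v := expR (- (1 * t)).
  have -> : u * (v * expR (- ((c - 1) * t))) + c * (u * t * v) =
     u * v * (expR (- ((c - 1) * t)) + c * t) by ring.
  have -> : u * v + u * t * v = u * v * (1 + t) by ring.
  rewrite ler_wpM2l// ?mulr_ge0 ?powR_ge0 ?expR_ge0//.
  by have := expR_ge1Dx (- ((c - 1) * t)); lra.
have df c : 0 < c -> is_derive c 1 f ((- s * c `^ (- s - 1)) * Gamma s + Gamma (s + 1)).
  move=> c0; have d1 := is_derive1_powR (- s) c0.
  have d2 := is_deriveZ (Gamma s) d1.
  have d3 := is_deriveZ (Gamma (s + 1)) (is_derive_id c (1 : R)).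
  have d4 := is_deriveD d2 d3.
  have fE : f = (Gamma s \*: (powR (R:=R))^~ (- s)) + (Gamma (s + 1) \*: id).
    by apply/funext => x; rewrite /f mulrC (mulrC x).
  rewrite fE; apply: is_derive_eq d4 _.
  by rewrite /GRing.scale/= mulr1 mulrC.
have f' : is_derive (1 : R) 1 f 0.
  apply: (@derive1_at_min R f 0 2 1) => //.
  - by move=> t; rewrite in_itv/= => /andP[t0 _]; have [] := df _ t0.
  - by rewrite in_itv/= ltr01 ltr1n.
  - by move=> t; rewrite in_itv/= => /andP[t0 _]; exact: f_min.
have := @derive_val _ _ _ _ _ _ _ (df 1 ltr01).
rewrite (derive_val (is_derive := f')) powR1/=.
by move: (Gamma s) (Gamma (s + 1)) => x y; lra.
Qed.
End gamma_function.

(** * Series with nonnegative terms and the exponential series *)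

Section nonneg_series.
Context {R : realType}.
Implicit Types (f : nat -> R) (l : R).

Lemma nneseries_EFinP f l : (forall n, 0 <= f n) ->
  (series f @ \oo --> l) <-> (\sum_(0 <= n <oo) (f n)%:E = l%:E)%E.
Proof.
move=> f0.
have E : (fun n => \sum_(0 <= k < n) (f k)%:E)%E = EFin \o series f.
  by apply/funext => n /=; rewrite sumEFin.
split => [fl|H].
  by apply/cvg_lim => //; rewrite E; apply/fine_cvgP; split => //; exact: nearW.
have : (fun n => \sum_(0 <= k < n) (f k)%:E)%E @ \oo --> l%:E.
  by rewrite -H; apply: is_cvg_nneseries => n _ _; rewrite lee_fin.
by rewrite E => /fine_cvg.
Qed.

Lemma nneseries_recl (u v : nat -> \bar R) (c : \bar R) :
  (forall n, 0 <= u n)%E -> u 0%N = c -> (forall n, u n = v n) ->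
  (\sum_(0 <= n <oo) u n = c + \sum_(1 <= n <oo) v n)%E.
Proof.
move=> u0 uc uv; rewrite (nneseries_split 0 1)// big_nat1 uc; congr (_ + _)%E.
by apply: eq_eseriesr => n _; exact: uv.
Qed.

Lemma series_expR (y : R) : series (fun n => y ^+ n / n`!%:R) @ \oo --> expR y.
Proof. by rewrite expRE /pseries -exp_coeffE; exact: is_cvg_series_exp_coeff. Qed.

Lemma nneseries_expR (y : R) : 0 <= y ->
  (\sum_(0 <= n <oo) (y ^+ n / n`!%:R)%:E = (expR y)%:E)%E.
Proof.
move=> y0; apply/nneseries_EFinP; last exact: series_expR.
by move=> n; rewrite divr_ge0// exprn_ge0.
Qed.

End nonneg_series.

(** * The binomial series with Gamma coefficients and the growth of Gamma (s + n) *)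

Section gamma_series.
Context {R : realType}.
Implicit Types s c x r : R.
Local Notation leb := (@lebesgue_measure R).

(** Expand e^(r t) in the integral of t^(s-1) e^(-(1-r) t); each power of t shifts the Gamma
    argument, and the terms are nonnegative, so the sum and the integral commute. *)
Lemma Gamma_binomial_series s r : 0 < s -> 0 <= r < 1 ->
  (\sum_(0 <= m <oo) (r ^+ m / m`!%:R * Gamma (s + m%:R))%:E =
   ((1 - r) `^ (- s) * Gamma s)%:E)%E.
Proof.
move=> s0 /andP[r0 r1].
rewrite -integral_gamma_kernel ?subr_gt0//.
have sm (m : nat) : 0 < s + m%:R by rewrite ltr_wpDr.
pose f (m : nat) (t : R) := ((r ^+ m / m`!%:R)%:E *
  (t `^ (s + m%:R - 1) * expR (- (1 * t)))%:E)%E.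
transitivity (\int[leb]_(t in `]0%R, +oo[) \sum_(0 <= m <oo) f m t)%E.
  rewrite integral_nneseries//.
  - apply: eq_eseriesr => m _; rewrite /f ge0_integralZl//=.
    + by rewrite EFin_Gamma.
    + by apply/measurable_EFinP; exact: measurable_gamma_kernel.
    + by move=> t _; rewrite lee_fin gamma_kernel_ge0.
    + by rewrite lee_fin divr_ge0// exprn_ge0.
  - move=> n; apply: emeasurable_funM => //.
    by apply/measurable_EFinP; exact: measurable_gamma_kernel.
  - move=> n x _; rewrite mule_ge0// lee_fin ?gamma_kernel_ge0//.
    by rewrite divr_ge0// exprn_ge0.
apply: eq_integral => t; rewrite inE/= in_itv/= andbT => t0.
transitivity (\sum_(0 <= m <oo) ((t `^ (s - 1) * expR (- (1 * t)))%:E *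
   ((r * t) ^+ m / m`!%:R)%:E))%E.
  apply: eq_eseriesr => m _; rewrite /f -!EFinM; congr EFin.
  have -> : t `^ (s + m%:R - 1) = t `^ (s - 1) * t ^+ m.
    rewrite -powR_mulrn ?ltW// -powRD; first by congr (_ `^ _); ring.
    by apply/implyP => _; rewrite gt_eqF.
  by rewrite exprMn; ring.
rewrite nneseriesZl; last first.
  by move=> m _; rewrite lee_fin divr_ge0// exprn_ge0// mulr_ge0// ltW.
rewrite nneseries_expR ?mulr_ge0// ?ltW// -EFinM; congr EFin.
by rewrite -mulrA -expRD; congr (_ * expR _); ring.
Qed.

Lemma GammaDnat_gt0 s (m : nat) : 0 < s -> 0 < Gamma (s + m%:R).
Proof. by move=> s0; rewrite Gamma_gt0// ltr_wpDr. Qed.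

Lemma GammaDnatS s (m : nat) : 0 < s ->
  Gamma (s + m.+1%:R) = (s + m%:R) * Gamma (s + m%:R).
Proof. by move=> s0; rewrite -natr1 addrA GammaS// ltr_wpDr. Qed.

(* The sequence n! (n + s) ^ (s - 1) / Gamma (s + n) is nonincreasing when
   1 <= s; the case s < 1 follows from s + 1. *)
Lemma fact_le_GammaDnat s : 0 < s -> exists2 C : R, 0 < C &
  forall n : nat, n`!%:R <= C * n.+1%:R `^ (1 - s) * Gamma (s + n%:R).
Proof.
have ge1 u : 1 <= u -> exists2 C : R, 0 < C &
    forall n : nat, n`!%:R <= C * n.+1%:R `^ (1 - u) * Gamma (u + n%:R).
  move=> u1; have u0 : 0 < u by exact: lt_le_trans u1.
  have v0 : 0 <= u - 1 by rewrite subr_ge0.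
  exists (u `^ (u - 1) / Gamma u); first by rewrite divr_gt0 ?powR_gt0 ?Gamma_gt0.
  move=> n; have -> : 1 - u = - (u - 1) by ring.
  rewrite powRN mulrAC ler_pdivlMr ?powR_gt0//.
  apply: (@le_trans _ _ (n`!%:R * (u + n%:R) `^ (u - 1))).
    rewrite ler_wpM2l//.
    have := @ge0_ler_powR R _ v0 n.+1%:R (u + n%:R).
    rewrite !nnegrE addr_ge0 ?(ltW u0)// => /(_ (ler0n _ _) isT); apply.
    by rewrite -natr1; lra.
  elim: n => [|n IH].
    by rewrite fact0 mul1r addr0 divfK// gt_eqF// Gamma_gt0.
  rewrite GammaDnatS// factS natrM; set m := u + n%:R.
  have m0 : 0 < m by rewrite /m ltr_pwDl.
  have mE : u + n.+1%:R = m + 1 by rewrite -natr1 addrA.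
  have nE : n.+1%:R = m - (u - 1) by rewrite -natr1 /m; ring.
  (* This bound and the next both come from 1 + x <= e^x, and their exponential factors are inverse
     to each other: the product gives the induction step without any loss. *)
  have pow_le : (m + 1) `^ (u - 1) <= m `^ (u - 1) * expR (m^-1 * (u - 1)).
    rewrite expRM -powRM ?expR_ge0 ?(ltW m0)//.
    have := @ge0_ler_powR R _ v0 (m + 1) (m * expR m^-1).
    rewrite !nnegrE addr_ge0 ?mulr_ge0 ?expR_ge0 ?(ltW m0)// => /(_ isT isT); apply.
    rewrite -ler_pdivrMl// mulrDr mulVf ?gt_eqF// mulr1.
    exact: expR_ge1Dx.
  have lin_le : n.+1%:R <= m * expR (- (m^-1 * (u - 1))).
    rewrite nE -ler_pdivrMl// mulrBr mulVf ?gt_eqF//.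
    exact: expR_ge1Dx.
  have := ler_pM (ler0n _ _) (powR_ge0 _ _) lin_le pow_le.
  rewrite mE mulrACA -expRD addNr expR0 mulr1 => H.
  rewrite mulrAC.
  have := ler_wpM2r (ler0n R n`!) H.
  have := ler_wpM2l (ltW m0) IH.
  by lra.
move=> s0; have [s1|s1] := leP 1 s; first exact: ge1.
have [C C0 HC] := ge1 (s + 1) ltac:(lra).
exists C; first exact: C0.
move=> n; apply: le_trans (HC n) _.
have -> : 1 - (s + 1) = - s by ring.
have -> : s + 1 + n%:R = s + n.+1%:R by rewrite -natr1; ring.
rewrite GammaDnatS//.
have -> : n.+1%:R `^ (1 - s) = n.+1%:R `^ (- s) * n.+1%:R :> R.
  by rewrite -[X in _ = _ * X](powRr1 (ler0n R n.+1)) -powRD ?pnatr_eq0 ?implybT// addrC.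
rewrite -!mulrA ler_wpM2l ?(ltW C0)// ler_wpM2l ?powR_ge0// ler_wpM2r ?Gamma_ge0//.
by rewrite -natr1; lra.
Qed.

End gamma_series.

(** * Integration against mu_alpha and domination by exponentials *)

Section gamma_measure_integral.
Context {R : realType} (alpha : R).
Hypothesis halpha : -1 < alpha.
Local Notation leb := (@lebesgue_measure R).
Local Notation mu := (gamma_measure alpha).
Local Notation s := (alpha + 1).

Let s_gt0 : 0 < s. Proof. by rewrite -ltrBlDr sub0r. Qed.

Lemma gamma_measure_setT : mu [set: R] = 1%E.
Proof.
rewrite /gamma_measure.
transitivity (\int[leb]_(x in `]0%R, +oo[)
   (((Gamma s)^-1)%:E * (x `^ (s - 1) * expR (- (1 * x)))%:E))%E.
  rewrite [RHS]integral_mkcond; apply: eq_integral => x _.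
  rewrite /gamma_pdf !patchE; case: ifP => // _.
  by rewrite addrK mul1r -EFinM mulrA.
rewrite ge0_integralZl//=.
- by rewrite EFin_Gamma// -EFinM mulVf// gt_eqF// Gamma_gt0.
- by apply/measurable_EFinP; exact: measurable_gamma_kernel.
- by move=> x _; rewrite lee_fin gamma_kernel_ge0.
- by rewrite lee_fin invr_ge0 Gamma_ge0.
Qed.

HB.instance Definition _ := Measure_isProbability.Build _ _ _
  mu gamma_measure_setT.

Lemma gamma_measure_dom : mu `<< leb.
Proof.
apply/null_content_dominatesP => A mA A0; rewrite /gamma_measure.
apply: null_set_integral => //.
by apply/measurable_funTS/measurable_EFinP; exact: measurable_gamma_pdf.
Qed.

(** The measure is built from set integrals of its density, so the density is almost everywhere the
    Radon-Nikodym derivative and change of variables applies. *)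
Lemma ge0_integral_gamma_measure (f : R -> \bar R) :
  measurable_fun [set: R] f -> (forall x, 0 <= f x)%E ->
  (\int[mu]_x f x =
   \int[leb]_(x in `]0%R, +oo[)
     (f x * ((Gamma s)^-1 * x `^ alpha * expR (- x))%:E))%E.
Proof.
move=> mf f0.
transitivity (\int[leb]_x (f x * (gamma_pdf alpha x)%:E))%E; last first.
  rewrite [RHS]integral_mkcond; apply: eq_integral => x _.
  rewrite /gamma_pdf !patchE; case: ifP => // _.
  by rewrite mule0.
rewrite -(Radon_Nikodym_SigmaFinite.change_of_variables gamma_measure_dom)//.
have mg : measurable_fun [set: R] (EFin \o gamma_pdf alpha).
  by apply/measurable_EFinP; exact: measurable_gamma_pdf.
have RNi := Radon_Nikodym_SigmaFinite.f_integrable gamma_measure_dom.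
have RN0 := Radon_Nikodym_SigmaFinite.f_ge0 gamma_measure_dom.
apply: ge0_ae_eq_integral => //.
- apply: emeasurable_funM => //; exact: (measurable_int _ RNi).
- exact: emeasurable_funM.
- by move=> x _; rewrite mule_ge0.
- by move=> x _; rewrite mule_ge0// lee_fin gamma_pdf_ge0.
apply: ae_eqe_mul2l; apply: integral_ae_eq => //.
move=> E _ mE.
rewrite -Radon_Nikodym_SigmaFinite.f_integral//.
exact: gamma_measure_dom.
Qed.

Lemma measurable_monomial_exp (k : nat) (tau : R) :
  measurable_fun [set: R] (fun x => (`|x| ^+ k * expR (tau * x))%:E).
Proof.
apply/measurable_EFinP; apply: measurable_funM.
  by apply: measurable_funX; exact: normr_measurable.
by apply: measurableT_comp => //; exact: measurable_funM.
Qed.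

(** The absolute value keeps the integrand nonnegative on the whole line; it is x^k almost
    everywhere, since the measure is carried by x > 0. *)
Lemma integral_monomial_exp (k : nat) (tau : R) : tau < 1 ->
  (\int[mu]_x (`|x| ^+ k * expR (tau * x))%:E =
   ((1 - tau) `^ (- (s + k%:R)) * Gamma (s + k%:R) / Gamma s)%:E)%E.
Proof.
move=> tau1; rewrite ge0_integral_gamma_measure; last 2 first.
- exact: measurable_monomial_exp.
- by move=> x; rewrite lee_fin mulr_ge0 ?exprn_ge0 ?expR_ge0.
transitivity (\int[leb]_(x in `]0%R, +oo[)
   (((Gamma s)^-1)%:E * (x `^ (s + k%:R - 1) * expR (- ((1 - tau) * x)))%:E))%E.
  apply: eq_integral => x; rewrite inE/= in_itv/= andbT => x0.
  rewrite -!EFinM; congr EFin; rewrite gtr0_norm//.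
  have -> : x `^ (s + k%:R - 1) = x `^ alpha * x ^+ k.
    rewrite -powR_mulrn ?ltW// -powRD; first by congr (_ `^ _); ring.
    by apply/implyP => _; rewrite gt_eqF.
  have -> : expR (- ((1 - tau) * x)) = expR (tau * x) * expR (- x).
    by rewrite -expRD; congr expR; ring.
  ring.
rewrite ge0_integralZl//=.
- rewrite integral_gamma_kernel ?subr_gt0//; last by rewrite ltr_wpDr.
  by rewrite -EFinM mulrC.
- by apply/measurable_EFinP; exact: measurable_gamma_kernel.
- by move=> x _; rewrite lee_fin gamma_kernel_ge0.
- by rewrite lee_fin invr_ge0 Gamma_ge0.
Qed.

Lemma gamma_measure_ae_gt0 : {ae mu, forall x, 0 < x}.
Proof.
exists `]-oo, 0%R]%classic; split => //.
  rewrite /gamma_measure integral0_eq// => x /=; rewrite in_itv/= => x0.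
  rewrite /gamma_pdf patchE ifF//; apply/negbTE; rewrite notin_setE/= in_itv/=.
  by rewrite andbT ltNge x0.
by move=> x /=; rewrite in_itv/= leNgt => /negP.
Qed.

Lemma measurable_exp_fun (D : set R) tau : measurable_fun D (exp_fun tau).
Proof.
by apply: measurable_funTS; apply: measurableT_comp.
Qed.

(** The L^r norm of e^(tau x) is (1 - r tau)^(-s/r). Integrability, membership in L^r and the
    explicit norm bounds below all reduce to this comparison, for which a pointwise bound on x > 0
    suffices. *)
Lemma Lnorm_le_exp (f : R -> R) (r tau C : R) :
  measurable_fun [set: R] f -> 0 <= C ->
  (forall x, 0 < x -> `|f x| <= C * expR (tau * x)) ->
  0 < r -> r * tau < 1 ->
  ('N[mu]_r%:E[EFin \o f] <= (C * (1 - r * tau) `^ (- (s / r)))%:E)%E.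
Proof.
move=> mf C0 fC r0 rt; rewrite unlock.
have H : (\int[mu]_x (`|(EFin \o f) x| `^ r) <=
    (C `^ r * (1 - r * tau) `^ (- s))%:E)%E.
  have -> : (C `^ r * (1 - r * tau) `^ (- s))%:E =
     (\int[mu]_x ((C `^ r)%:E * (`|x| ^+ 0 * expR (r * tau * x))%:E))%E.
    rewrite ge0_integralZl//=.
    - rewrite integral_monomial_exp// -EFinM; congr EFin.
      by rewrite addr0 mulfK// gt_eqF// Gamma_gt0.
    - exact: (measurable_monomial_exp 0).
    - by rewrite lee_fin powR_ge0.
  apply: ae_ge0_le_integral => //=.
  - apply/measurable_EFinP; apply: (measurableT_comp (measurable_powR _)) => //.
    exact: measurableT_comp.
  - by move=> x _; rewrite -EFinM lee_fin !mulr_ge0 ?powR_ge0 ?expR_ge0.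
  - by apply: emeasurable_funM => //; exact: (measurable_monomial_exp 0).
  - have := gamma_measure_ae_gt0; apply: (@filterS _ _ (ae_filter_ringOfSetsType mu)) => x x0 _.
    rewrite -EFinM lee_fin mul1r (_ : r * tau * x = tau * x * r); last by ring.
    rewrite expRM -powRM ?expR_ge0//.
    apply: (ge0_ler_powR (ltW r0)); rewrite ?nnegrE ?mulr_ge0 ?expR_ge0//.
    exact: fC.
apply: (@le_trans _ _ (((C `^ r * (1 - r * tau) `^ (- s))%:E) `^ r^-1)%E).
  apply: gt0_ler_poweR H; rewrite ?invr_ge0 ?(ltW r0)// in_itv/= leey andbT.
    by apply: integral_ge0 => x _; rewrite lee_fin powR_ge0.
  by rewrite lee_fin mulr_ge0 ?powR_ge0.
rewrite poweR_EFin powRM ?powR_ge0// -!powRrM divff ?gt_eqF// powRr1//.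
by rewrite mulNr.
Qed.

Lemma Lfun_le_exp (f : R -> R) (r tau C : R) :
  measurable_fun [set: R] f -> 0 <= C ->
  (forall x, 0 < x -> `|f x| <= C * expR (tau * x)) ->
  0 < r -> r * tau < 1 -> f \in Lfun mu r%:E.
Proof.
move=> mf C0 fC r0 rt; rewrite inE; apply/andP; split; rewrite inE//=.
by apply: le_lt_trans (ltry _); exact: Lnorm_le_exp fC _ _.
Qed.

Lemma integrable_le_exp (f : R -> R) (tau C : R) :
  measurable_fun [set: R] f -> 0 <= C ->
  (forall x, 0 < x -> `|f x| <= C * expR (tau * x)) ->
  tau < 1 -> mu.-integrable [set: R] (EFin \o f).
Proof.
move=> mf C0 fC tau1; apply/Lfun1_integrable.
by apply: Lfun_le_exp fC _ _ => //; rewrite mul1r.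
Qed.

Lemma poly_le_exp (P : {poly R}) (e : R) : 0 < e ->
  exists2 C, 0 <= C & forall x, 0 < x -> `|P.[x]| <= C * expR (e * x).
Proof.
elim/poly_ind: P e => [|P c IH] e e0.
  by exists 0 => // x _; rewrite horner0 normr0 mul0r.
(* Half of the rate serves the polynomial of lower degree, the other half absorbs the new factor
   through x <= e^(e x / 2) / (e / 2). *)
have e2 : 0 < e / 2 by rewrite divr_gt0.
have [C C0 HC] := IH _ e2.
exists (C / (e / 2) + `|c|); first by rewrite addr_ge0// divr_ge0// ltW.
move=> x x0; rewrite hornerMXaddC (le_trans (ler_normD _ _))// mulrDl lerD//; last first.
  by rewrite ler_peMr// -expR0 ler_expR mulr_ge0// ltW.
rewrite normrM (gtr0_norm x0).
have -> : expR (e * x) = expR (e / 2 * x) * expR (e / 2 * x).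
  by rewrite -expRD; congr expR; field.
have -> : C / (e / 2) * (expR (e / 2 * x) * expR (e / 2 * x)) =
   (C * expR (e / 2 * x)) * (expR (e / 2 * x) / (e / 2)) by ring.
apply: ler_pM => //; [exact: ltW|exact: HC|].
rewrite ler_pdivlMr// mulrC.
by have := expR_ge1Dx (e / 2 * x); lra.
Qed.

Lemma measurable_poly_exp (P : {poly R}) tau :
  measurable_fun [set: R] (fun x => P.[x] * expR (tau * x)).
Proof.
apply: measurable_funM; last exact: (@measurable_exp_fun setT tau).
exact: measurable_poly.
Qed.

Lemma poly_exp_le (P : {poly R}) tau e : 0 < e ->
  exists2 C, 0 <= C &
    forall x, 0 < x -> `|P.[x] * expR (tau * x)| <= C * expR ((tau + e) * x).
Proof.
move=> /poly_le_exp-/(_ P)[C C0 HC]; exists C => // x x0.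
rewrite normrM (ger0_norm (expR_ge0 _)) mulrDl expRD mulrA mulrAC.
by rewrite ler_wpM2r ?expR_ge0// HC.
Qed.

Lemma integrable_poly_exp (P : {poly R}) tau : tau < 1 ->
  mu.-integrable [set: R] (fun x => (P.[x] * expR (tau * x))%:E).
Proof.
move=> tau1; have e0 : 0 < (1 - tau) / 2 by rewrite divr_gt0// subr_gt0.
have [C C0 HC] := poly_exp_le P tau e0.
by apply: integrable_le_exp (measurable_poly_exp P tau) C0 HC _; lra.
Qed.

Lemma integral_poly_exp (P : {poly R}) (n : nat) tau : (size P <= n)%N -> tau < 1 ->
  (\int[mu]_x (P.[x] * expR (tau * x))%:E =
   (\sum_(i < n) P`_i *
      ((1 - tau) `^ (- (s + i%:R)) * Gamma (s + i%:R) / Gamma s))%:E)%E.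
Proof.
move=> Pn tau1.
have iX (i : nat) : mu.-integrable [set: R] (fun x => (x ^+ i * expR (tau * x))%:E).
  have := integrable_poly_exp 'X^i tau1.
  by under eq_fun do rewrite hornerXn.
transitivity (\int[mu]_x (\sum_(i < n) (P`_i)%:E * (x ^+ i * expR (tau * x))%:E))%E.
  apply: eq_integral => x _; rewrite (horner_coef_wide _ Pn) mulr_suml -sumEFin.
  by apply: eq_bigr => i _; rewrite -EFinM mulrA.
rewrite integral_sum//; last by move=> i; exact: integrableZl.
rewrite -sumEFin; apply: eq_bigr => i _; rewrite integralZl// EFinM; congr (_ * _)%E.
rewrite -integral_monomial_exp//.
apply: ae_eq_integral => //; [exact: measurable_int (iX i)|exact: measurable_monomial_exp|].
have := gamma_measure_ae_gt0.
apply: (@filterS _ _ (ae_filter_ringOfSetsType mu)) => x x0 _.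
by rewrite gtr0_norm.
Qed.

End gamma_measure_integral.

(** * Uniqueness of the coefficients of a power series *)

Section power_series_uniqueness.
Context {R : realType}.

(** Convergence at r = 1/2 gives |e n| <= M 2^n. If N is the first index with a nonzero coefficient,
    the terms beyond N are O(r^(N+1)), which contradicts a zero sum when r is small. *)
Lemma pseries_eq0 (e : nat -> R) :
  (forall r, 0 <= r < 1 -> series (fun n => e n * r ^+ n) @ \oo --> (0 : R)) ->
  forall n, e n = 0.
Proof.
move=> He.
have h2 : 0 <= (2^-1 : R) < 1 by apply/andP; split; lra.
have [M M0 HM] : exists2 M : R, 0 < M & forall n, `|e n| <= M * 2 ^+ n.
  have : cvgn (fun n => e n * 2^-1 ^+ n).
    have : cvgn (series (fun n => e n * 2^-1 ^+ n)) by apply/cvg_ex; exists 0; exact: He.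
    by move/cvg_series_cvg_0 => H; apply/cvg_ex; exists 0.
  move/cvg_seq_bounded => [M [_ HM]].
  exists (`|M| + 1); first by rewrite ltr_wpDl.
  move=> n; have /HM/(_ n I) : M < `|M| + 1.
    by rewrite (le_lt_trans (ler_norm _))// ltrDl.
  by rewrite /= normrM normrX (@ger0_norm _ (2^-1 : R))// exprVn ler_pdivrMr// exprn_gt0.
move=> n; elim/ltn_ind: n => N IH.
apply/eqP/negPn/negP => eN0.
have key (r : R) : 0 < r -> r <= 4^-1 -> `|e N| <= M * 2 ^+ N.+2 * r.
  move=> r0 r4; have r01 : 0 <= r < 1 by apply/andP; split; lra.
  pose S := series (fun n => e n * r ^+ n).
  have SN : S N = 0.
    by rewrite /S /series/= big_nat big1// => i /andP[_ iN]; rewrite IH// mul0r.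
  have q0 : 0 <= 2 * r by lra.
  (* Since 2 r <= 1/2, M (2 r)^j <= 2 M ((2 r)^j - (2 r)^(j+1)): the geometric bound on the tail is
     put in telescoping form. *)
  have Sm m : `|S (N.+1 + m)%N - e N * r ^+ N| <=
      2 * M * ((2 * r) ^+ N.+1 - (2 * r) ^+ (N.+1 + m)).
    elim: m => [|m IHm].
      by rewrite addn0 subrr mulr0 /S seriesSr -/S SN add0r subrr normr0.
    rewrite addnS /S seriesSr -/S addrAC (le_trans (ler_normD _ _))//.
    have : `|e (N.+1 + m)%N * r ^+ (N.+1 + m)| <= M * (2 * r) ^+ (N.+1 + m).
      rewrite normrM normrX (gtr0_norm r0) exprMn mulrA ler_wpM2r ?exprn_ge0 ?(ltW r0)//.
    have : 0 <= M * (2 * r) ^+ (N.+1 + m) by rewrite mulr_ge0 ?exprn_ge0// ltW.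
    move: IHm; rewrite [in X in _ -> _ -> _ -> X](exprS _ (N.+1 + m)).
    set u := (2 * r) ^+ (N.+1 + m); set v := (2 * r) ^+ N.+1 => a1 a2 a3.
    have : 0 <= M * u * (1 - 2 * (2 * r)) by rewrite mulr_ge0//; lra.
    by nra.
  have : `|0 - e N * r ^+ N| <= 2 * M * (2 * r) ^+ N.+1.
    have C : `|S m - e N * r ^+ N| @[m --> \oo] --> `|0 - e N * r ^+ N|.
      by apply: cvg_norm; apply: cvgB; [exact: He|exact: cvg_cst].
    apply: (cvgr_to_le C); near=> m.
    have Nm : (N.+1 <= m)%N by near: m; exact: nbhs_infty_ge.
    rewrite -(subnKC Nm) (le_trans (Sm _))// ler_wpM2l ?mulr_ge0 ?(ltW M0)//.
    by rewrite gerBl exprn_ge0.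
  rewrite sub0r normrN normrM normrX (gtr0_norm r0) exprMn !exprS.
  have rN : 0 < r ^+ N by rewrite exprn_gt0.
  rewrite -(ler_pM2r rN (`|e N|)); lra.
have e0 : 0 < `|e N| by rewrite normr_gt0.
pose K := M * 2 ^+ N.+2.
have K0 : 0 < K by rewrite mulr_gt0 ?exprn_gt0.
(* At this [r], [key] would give |e N| <= |e N| / 2. *)
pose r := Num.min 4^-1 (`|e N| / (2 * K)).
have r0 : 0 < r by rewrite lt_min invr_gt0 ltr0n/= divr_gt0// mulr_gt0.
have := key r r0; rewrite ge_min lexx => /(_ isT).
have : K * r <= K * (`|e N| / (2 * K)) by rewrite ler_pM2l// ge_min lexx orbT.
have -> : K * (`|e N| / (2 * K)) = `|e N| / 2 by field; rewrite gt_eqF.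
by rewrite -/K; lra.
Unshelve. all: by end_near. Qed.

End power_series_uniqueness.

(** * Laguerre polynomials: closed form, inversion, integrals against exponentials *)

Lemma bin_factE {R : numFieldType} (n k : nat) : (k <= n)%N ->
  'C(n, k)%:R = n`!%:R / (k`!%:R * (n - k)`!%:R) :> R.
Proof.
move=> kn; rewrite -(bin_fact kn) !natrM mulfK//.
Qed.

Section laguerre.
Context {R : realType} (s : R).
Hypothesis s_gt0 : 0 < s.

(** The classical closed form of L_n^alpha for alpha = s - 1: the k-th coefficient is (-1)^k / k!
    times the generalized binomial of n + alpha over n - k. *)
Definition laguerre_poly (n : nat) : {poly R} :=
  \poly_(k < n.+1) ((-1) ^+ k * Gamma (s + n%:R) /
                     (k`!%:R * Gamma (s + k%:R) * (n - k)`!%:R)).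

Let G0 (k : nat) : Gamma (s + k%:R) != 0.
Proof. by rewrite gt_eqF// GammaDnat_gt0. Qed.

Let F0 (k : nat) : k`!%:R != 0 :> R.
Proof. by rewrite pnatr_eq0 -lt0n fact_gt0. Qed.

Lemma laguerre_poly_ge0 n (y : R) : 0 <= y -> 0 <= (laguerre_poly n).[- y].
Proof.
move=> y0; rewrite horner_poly sumr_ge0// => k _.
have -> : (- y) ^+ k = (-1) ^+ k * y ^+ k by rewrite -exprMn mulN1r.
rewrite [X in 0 <= X](_ : _ = ((-1) ^+ k * (-1) ^+ k) * (Gamma (s + n%:R) * y ^+ k /
   (k`!%:R * Gamma (s + k%:R) * (n - k)`!%:R))); last by ring.
by rewrite -expr2 sqrr_sign mul1r divr_ge0 ?mulr_ge0 ?exprn_ge0 ?Gamma_ge0.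
Qed.

(** After the exchange of the two sums, the inner one over n = m + k is the binomial series with
    parameter s + k, and the outer one is an exponential series in r y / (1 - r). *)
Lemma laguerre_poly_generating (y r : R) : 0 <= y -> 0 <= r < 1 ->
  (\sum_(0 <= n <oo) ((laguerre_poly n).[- y] * r ^+ n)%:E =
   ((1 - r) `^ (- s) * expR (r / (1 - r) * y))%:E)%E.
Proof.
move=> y0 /andP[r0 r1].
pose c n k : R := y ^+ k / k`!%:R *
  (r ^+ n * Gamma (s + n%:R) / (Gamma (s + k%:R) * (n - k)`!%:R)).
have c0 n k : 0 <= c n k.
  rewrite /c !mulr_ge0 ?invr_ge0 ?exprn_ge0 ?Gamma_ge0//.
  by rewrite mulr_ge0 ?Gamma_ge0.
(* Padding with zeros turns the triangular sum into a double series over all pairs, to which the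
   exchange of nonnegative sums applies. *)
pose a n k : \bar R := if (k <= n)%N then (c n k)%:E else 0%E.
have a0 n k : (0 <= a n k)%E by rewrite /a; case: ifP => // _; rewrite lee_fin.
transitivity (\sum_(0 <= n <oo) \sum_(0 <= k <oo) a n k)%E.
  apply: eq_eseriesr => n _.
  rewrite (nneseries_split 0 n.+1)// add0n [X in (_ + X)%E]eseries0 ?adde0; last first.
    by move=> k nk _; rewrite /a leqNgt nk.
  rewrite big_mkord horner_poly mulr_suml -sumEFin; apply: eq_bigr => k _.
  rewrite /a -ltnS ltn_ord /c; congr EFin.
  have -> : (- y) ^+ k = (-1) ^+ k * y ^+ k by rewrite -exprMn mulN1r.
  have uu : (-1) ^+ k * (-1) ^+ k = 1 :> R by rewrite -expr2 sqrr_sign.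
  rewrite -[RHS]mul1r -[X in _ = X * _]uu.
  move: (G0 k) (F0 k) (F0 (n - k)%N).
  move: (Gamma (s + k%:R)) (Gamma _) ((-1) ^+ k) => Gk Gn u h1 h2 h3.
  by field; rewrite h1 h2 h3.
rewrite nneseries_interchange//.
transitivity (\sum_(0 <= k <oo) ((1 - r) `^ (- s))%:E * ((r / (1 - r) * y) ^+ k / k`!%:R)%:E)%E.
  apply: eq_eseriesr => k _.
  rewrite (nneseries_split 0 k)// add0n big_nat big1 ?add0e; last first.
    by move=> i /andP[_ ik]; rewrite /a leqNgt ik.
  rewrite -(nneseries_addn k)//.
  transitivity (\sum_(0 <= m <oo) (y ^+ k / k`!%:R * r ^+ k / Gamma (s + k%:R))%:E *
      (r ^+ m / m`!%:R * Gamma (s + k%:R + m%:R))%:E)%E.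
    apply: eq_eseriesr => m _; rewrite /a leq_addl -EFinM /c addnK; congr EFin.
    have -> : s + (m + k)%:R = s + k%:R + m%:R by rewrite natrD; ring.
    rewrite exprD; move: (G0 k) (F0 k) (F0 m).
    move: (Gamma (s + k%:R)) (Gamma _) => Gk Gm h1 h2 h3.
    by field; rewrite h1 h2 h3.
  rewrite nneseriesZl; last first.
    move=> m _; rewrite lee_fin mulr_ge0 ?Gamma_ge0// divr_ge0// exprn_ge0//.
  rewrite Gamma_binomial_series ?r0 ?r1//; last by rewrite ltr_wpDr.
  rewrite -!EFinM; congr EFin.
  have r10 : 0 < 1 - r by rewrite subr_gt0.
  have -> : (1 - r) `^ (- (s + k%:R)) = (1 - r) `^ (- s) / (1 - r) ^+ k.
    rewrite opprD powRD; last by apply/implyP => _; rewrite gt_eqF.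
    by rewrite powR_invn// ltW.
  by rewrite !exprMn exprVn; field; rewrite G0 F0 -?andbA expf_neq0// gt_eqF.
have ry0 : 0 <= r / (1 - r) * y by rewrite mulr_ge0// divr_ge0// subr_ge0 ltW.
rewrite nneseriesZl ?nneseries_expR ?EFinM// => k _.
by rewrite lee_fin divr_ge0// exprn_ge0.
Qed.

(** The generating functions are compared only for x <= 0 and 0 <= r < 1. This is enough: the
    difference of the two polynomials vanishes at 0, -1, -2, ..., hence at as many points as its
    size. *)
Lemma is_laguerreE (L : nat -> {poly R}) n :
  is_laguerre (s - 1) L -> L n = laguerre_poly n.
Proof.
move=> HL; apply/eqP; rewrite -subr_eq0; apply/eqP.
set p := _ - _.
have p0 y : 0 <= y -> p.[- y] = 0.
  move=> y0; rewrite /p hornerD hornerN.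
  apply: (@pseries_eq0 _ (fun k => (L k).[- y] - (laguerre_poly k).[- y])) => r r01.
  have r1 : `|r| < 1 by case/andP: r01 => r0 r1; rewrite ger0_norm.
  have lag := laguerre_poly_generating y0 r01.
  have lag0 k : 0 <= (laguerre_poly k).[- y] * r ^+ k.
    by case/andP: r01 => r0 _; rewrite mulr_ge0 ?exprn_ge0// laguerre_poly_ge0.
  have := cvgB (HL (- y) r r1) ((nneseries_EFinP _ lag0).2 lag).
  rewrite (_ : - (s - 1) - 1 = - s); last by ring.
  rewrite mulrNN subrr => H.
  have -> : series (fun k => ((L k).[- y] - (laguerre_poly k).[- y]) * r ^+ k) =
      series (fun k => (L k).[- y] * r ^+ k) -
      series (fun k => (laguerre_poly k).[- y] * r ^+ k).
    apply/funext => m; rewrite fctE /series/= -sumrB.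
    by apply: eq_bigr => i _; rewrite mulrBl.
  exact: H.
apply: (@roots_geq_poly_eq0 _ p [seq - i%:R | i <- iota 0 (size p)]).
- by apply/allP => _ /mapP[i _ ->]; apply/rootP; exact: p0.
- rewrite map_inj_uniq ?iota_uniq// => i j /oppr_inj/eqP.
  by rewrite eqr_nat => /eqP.
- by rewrite size_map size_iota.
Qed.

(** Used at x = 1 for the inversion and at x = (1 - tau)^-1 for the integral against e^(tau x). *)
Lemma sum_sign_bin (N : nat) (x : R) :
  \sum_(k < N.+1) (-1) ^+ k * 'C(N, k)%:R * x ^+ k = (1 - x) ^+ N.
Proof.
rewrite exprDn; apply: eq_bigr => i _.
by rewrite expr1n mul1r -[in RHS]mulN1r exprMn -[in RHS]mulr_natr; ring.
Qed.

Lemma Xn_laguerre_poly (j : nat) :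
  'X^j = \sum_(n < j.+1) ((-1) ^+ n * j`!%:R * Gamma (s + j%:R) /
            (Gamma (s + n%:R) * (j - n)`!%:R)) *: laguerre_poly n.
Proof.
apply/polyP => k; rewrite coefXn coef_sum.
under eq_bigr do rewrite coefZ coef_poly ltnS.
have [jk|kj] := ltnP j k.
  rewrite gtn_eqF// big1// => i _.
  by rewrite leqNgt (leq_trans (ltn_ord i) jk) mulr0.
pose K : R := j`!%:R * Gamma (s + j%:R) / (k`!%:R * Gamma (s + k%:R) * (j - k)`!%:R).
(* With n = m + k, the coefficient of X^k on the right is K (1 - 1)^(j - k), which vanishes unless j
   = k, where K = 1. *)
transitivity (\sum_(m < (j - k).+1) K * ((-1) ^+ m * 'C(j - k, m)%:R * 1 ^+ m)).
  rewrite -mulr_sumr sum_sign_bin subrr expr0n subn_eq0 eqn_leq kj/=.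
  case: leqP => [jk|]; last by rewrite mulr0.
  have -> : K = 1; last by rewrite mulr1.
  have -> : K = j`!%:R * Gamma (s + j%:R) / (k`!%:R * Gamma (s + k%:R) * (j - k)`!%:R) by [].
  have -> : j = k by apply/eqP; rewrite eqn_leq jk kj.
  by rewrite subnn fact0; field; rewrite F0 G0.
pose F (n : nat) : R := (-1) ^+ n * j`!%:R * Gamma (s + j%:R) /
  (Gamma (s + n%:R) * (j - n)`!%:R) * (if (k <= n)%N then
    (-1) ^+ k * Gamma (s + n%:R) / (k`!%:R * Gamma (s + k%:R) * (n - k)`!%:R) else 0).
have Z : \sum_(0 <= i < k) F i = 0.
  by rewrite big_nat big1// => i /andP[_ ik]; rewrite /F leqNgt ik mulr0.
rewrite -(big_mkord xpredT F) (big_cat_nat _ _ (n := k))//=; last exact: leqW.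
rewrite Z add0r.
have -> : \sum_(k <= i < j.+1) F i = \sum_(0 + k <= i < j.+1) F i by [].
rewrite big_addn subSn// big_mkord; apply: eq_bigr => m _.
have mjk : (m <= j - k)%N by rewrite -ltnS.
rewrite /F leq_addl addnK expr1n mulr1 (bin_factE mjk) /K.
have -> : (j - (m + k) = j - k - m)%N by rewrite addnC subnDA.
have uu : (-1) ^+ k * (-1) ^+ k = 1 :> R by rewrite -expr2 sqrr_sign.
rewrite exprD -[LHS]mul1r -[X in X * _ = _]uu.
move: (G0 k) (G0 (m + k)%N) (F0 k) (F0 m) (F0 (j - k)%N) (F0 (j - k - m)%N).
move: (Gamma (s + k%:R)) (Gamma (s + (m + k)%:R)) (Gamma _) ((-1) ^+ k) => Gk Gmk Gj u.
by move=> h1 h2 h3 h4 h5 h6; field; rewrite h1 h2 h3 h4 h5 h6.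
Qed.

End laguerre.

(** The moments of e^(tau x) cancel the Gamma factors in the denominators of the coefficients; what
    is left is the alternating binomial sum of (1 - tau)^(-k), that is (1 - 1/(1 - tau))^n. *)
Lemma integral_laguerre_poly_exp {R : realType} (alpha : R) n tau : -1 < alpha -> tau < 1 ->
  (\int[gamma_measure alpha]_x ((laguerre_poly (alpha + 1) n).[x] * expR (tau * x))%:E =
   (Gamma (alpha + 1 + n%:R) / (n`!%:R * Gamma (alpha + 1)) *
    (1 - tau) `^ (- (alpha + 1)) * (- (tau / (1 - tau))) ^+ n)%:E)%E.
Proof.
move=> halpha tau1; rewrite (@integral_poly_exp _ _ halpha _ n.+1)//; last exact: size_poly.
have s0 : 0 < alpha + 1 by lra.
have t0 : 0 < 1 - tau by rewrite subr_gt0.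
have tn0 : 1 - tau != 0 by rewrite gt_eqF.
have G0 (k : nat) : Gamma (alpha + 1 + k%:R) != 0 by rewrite gt_eqF// GammaDnat_gt0.
have G00 : Gamma (alpha + 1) != 0 by rewrite gt_eqF// Gamma_gt0.
have F0 (k : nat) : k`!%:R != 0 :> R by rewrite pnatr_eq0 -lt0n fact_gt0.
congr EFin; have -> : - (tau / (1 - tau)) = 1 - (1 - tau)^-1 by field.
rewrite -sum_sign_bin mulr_sumr; apply: eq_bigr => k _.
have kn : (k <= n)%N by rewrite -ltnS.
rewrite coef_poly ltn_ord (bin_factE kn).
have -> : (1 - tau) `^ (- (alpha + 1 + k%:R)) = (1 - tau) `^ (- (alpha + 1)) / (1 - tau) ^+ k.
  rewrite opprD powRD; last by apply/implyP.
  by rewrite powR_invn// ltW.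
rewrite exprVn; set u := (-1) ^+ k.
have w0 : (1 - tau) ^+ k != 0 by rewrite expf_neq0.
move: (G0 k) G00 (F0 k) (F0 n) (F0 (n - k)%N) w0.
move: (Gamma (alpha + 1 + k%:R)) (Gamma (alpha + 1 + n%:R)) (Gamma _) (_ `^ _).
move: (_ ^+ k) => w Gk Gn Gs v h1 h2 h3 h4 h5 h6.
by field; rewrite h1 h2 h3 h4 h5 h6.
Qed.

(** * Bounded operators between L^p spaces, up to almost-everywhere equality *)

Section bounded_operators.
Context d (X : measurableType d) (R : realType).
Variable mu : {measure set X -> \bar R}.
Implicit Types (f g : X -> R) (r p q K : R) (T : (X -> R) -> X -> R).

Lemma Lfun_measurable f r : f \in Lfun mu r%:E -> measurable_fun [set: X] f.
Proof. by rewrite inE => /andP[]; rewrite inE. Qed.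

Lemma Lfun_Lnorm_lty f r : f \in Lfun mu r%:E -> ('N[mu]_r%:E[EFin \o f] < +oo)%E.
Proof. by rewrite inE => /andP[_]; rewrite inE. Qed.

Lemma ae_eq_Lnorm f g r : measurable_fun [set: X] f -> measurable_fun [set: X] g ->
  f = g %[ae mu] -> 'N[mu]_r%:E[EFin \o f]%E = 'N[mu]_r%:E[EFin \o g]%E.
Proof.
move=> mf mg fg; rewrite unlock; congr (_ `^ _)%E.
have mr (h : X -> R) : measurable_fun [set: X] h ->
    measurable_fun [set: X] (fun x => `|(EFin \o h) x| `^ r)%E.
  move=> mh; apply/measurable_EFinP; apply: (measurableT_comp (measurable_powR _)) => //.
  exact: measurableT_comp.
apply: ae_eq_integral => //; [exact: mr|exact: mr|].
by move: fg; apply: filterS => x /[apply] /= ->.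
Qed.

Lemma Lnorm_scale f r (c : R) : 1 <= r -> f \in Lfun mu r%:E ->
  'N[mu]_r%:E[EFin \o (fun x => (c * f x)%R)]%E = (`|c|%:E * 'N[mu]_r%:E[EFin \o f])%E.
Proof.
move=> r1 fr; have r1' : (1%:E <= r%:E)%E by rewrite lee_fin.
exact: (LnormZ (Lfun_Sub r1' fr) c).
Qed.

Lemma Lfun0 r : 1 <= r -> (fun=> 0) \in Lfun mu r%:E.
Proof.
move=> r1; have r1' : (1%:E <= r%:E)%E by rewrite lee_fin.
exact: (Lfun_submod_closed mu r1').1.
Qed.

Lemma Lfun_linear f g r (c : R) : 1 <= r -> f \in Lfun mu r%:E -> g \in Lfun mu r%:E ->
  (fun x => c * f x + g x) \in Lfun mu r%:E.
Proof.
move=> r1; have r1' : (1%:E <= r%:E)%E by rewrite lee_fin.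
exact: (Lfun_submod_closed mu r1').2.
Qed.

Lemma hoelder_integrable f g p q : 0 < p -> 0 < q -> p^-1 + q^-1 = 1 ->
  f \in Lfun mu p%:E -> g \in Lfun mu q%:E ->
  mu.-integrable [set: X] (fun x => (f x * g x)%:E) /\
  (`|\int[mu]_x (f x * g x)%:E| <= 'N[mu]_p%:E[EFin \o f] * 'N[mu]_q%:E[EFin \o g])%E.
Proof.
move=> p0 q0 pq fp gq.
have mf := Lfun_measurable fp; have mg := Lfun_measurable gq.
have H := hoelder mu mf mg p0 q0 pq.
have Hf := Lfun_Lnorm_lty fp; have Hg := Lfun_Lnorm_lty gq.
have mfg : measurable_fun [set: X] (fun x => (f x * g x)%:E).
  by apply/measurable_EFinP; exact: measurable_funM.
split.
  apply/integrableP; split => //.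
  rewrite -Lnorm1; apply: le_lt_trans H _.
  by apply: lte_mul_pinfty => //; rewrite ?ge0_fin_numE// Lnorm_ge0.
apply: (le_trans (le_abse_integral _ _ _)) => //.
by rewrite -Lnorm1.
Qed.

Section bounded.
Variables (p q : R) (T : (X -> R) -> X -> R).
Hypotheses (p1 : 1 <= p) (q1 : 1 <= q) (bT : bounded_operator mu p q T).

Lemma operator0 : T (fun=> 0) = (fun=> 0) %[ae mu].
Proof.
have := operator_linear bT 1 (Lfun0 p1) (Lfun0 p1).
have -> : (fun x : X => 1 * 0 + 0) = (fun=> 0) :> (X -> R).
  by apply/funext => x; rewrite mul1r addr0.
by apply: filterS => x /[apply] /=; lra.
Qed.

Lemma operator_scale (c : R) f : f \in Lfun mu p%:E ->
  T (fun x => c * f x) = (fun x => c * T f x) %[ae mu].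
Proof.
move=> fp; have := operator_linear bT c fp (Lfun0 p1).
have -> : (fun x => c * f x + 0) = (fun x => c * f x).
  by apply/funext => x; rewrite addr0.
move: operator0; apply: filterS2 => x h0 h _.
by rewrite (h I) (h0 I) addr0.
Qed.

(** Rescaling by a positive bound [K] in place of the norm of [f] avoids a separate case for norm
    zero, and suits the explicit upper bounds available for the norms. *)
Lemma le_operator_norm f K : f \in Lfun mu p%:E -> 0 < K ->
  ('N[mu]_p%:E[EFin \o f] <= K%:E)%E ->
  ('N[mu]_q%:E[EFin \o T f] <= operator_norm mu p q T * K%:E)%E.
Proof.
move=> fp K0 fK.
have fKp : (fun x => K^-1 * f x) \in Lfun mu p%:E.
  have := Lfun_linear K^-1 p1 fp (Lfun0 p1).
  by under eq_fun do rewrite addr0.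
have mTf := Lfun_measurable (operator_Lfun bT fp).
have := ae_eq_Lnorm q (Lfun_measurable (operator_Lfun bT fKp))
   (measurable_funM (measurable_cst K^-1) mTf) (operator_scale K^-1 fp).
rewrite (Lnorm_scale K^-1 q1 (operator_Lfun bT fp)) => E.
have : ('N[mu]_q%:E[EFin \o T (fun x => (K^-1 * f x)%R)] <= operator_norm mu p q T)%E.
  apply: ereal_sup_ubound; exists (fun x => K^-1 * f x) => //; split => //.
  rewrite Lnorm_scale// gtr0_norm ?invr_gt0//.
  by rewrite -(@mulVf _ K) ?gt_eqF// EFinM lee_pmul2l ?lte_fin ?invr_gt0.
rewrite E gtr0_norm ?invr_gt0// => H.
rewrite muleC -lee_pdivrMl//.
Qed.

Lemma operator_norm_ge0 : (0 <= operator_norm mu p q T)%E.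
Proof.
apply: (le_trans (Lnorm_ge0 mu q%:E (EFin \o T (fun=> 0)))).
apply: ereal_sup_ubound; exists (fun=> 0) => //; split; first exact: Lfun0.
by rewrite (@Lnorm0 _ _ _ mu p%:E)// eqe gt_eqF// (lt_le_trans ltr01).
Qed.

Lemma operator_norm_lty : (operator_norm mu p q T < +oo)%E.
Proof.
have [M HM] := operator_bounded bT.
apply: (@le_lt_trans _ _ `|M|%:E); last exact: ltry.
apply: ub_ereal_sup => _ [f [fp f1] <-].
apply: (le_trans (HM _ fp)); apply: (@le_trans _ _ (`|M|%:E * 'N[mu]_p%:E[EFin \o f])%E).
  by rewrite lee_wpmul2r ?Lnorm_ge0// lee_fin ler_norm.
by rewrite -[leRHS]mule1 lee_wpmul2l// lee_fin.
Qed.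

End bounded.
End bounded_operators.

(** * Taylor remainders of the exponential and limits of triangular sums *)

Section real_series.
Context {R : realType}.

(** For j >= J, kappa^j <= kappa^J, so the tail of e^(kappa y) is at most kappa^J times the tail of
    e^y. With kappa = tau1 / tau and y = tau x, a slightly larger rate buys a geometrically small
    factor. *)
Lemma expR_taylor_bounds (kappa y : R) (J : nat) : 0 <= kappa <= 1 -> 0 <= y ->
  \sum_(j < J) (kappa * y) ^+ j / j`!%:R <= expR (kappa * y) <=
  \sum_(j < J) (kappa * y) ^+ j / j`!%:R + kappa ^+ J * expR y.
Proof.
move=> /andP[k0 k1] y0; rewrite -!(big_mkord xpredT (fun j => (kappa * y) ^+ j / j`!%:R)).
pose u (z : R) (j : nat) := z ^+ j / j`!%:R.
have u0 z j : 0 <= z -> 0 <= u z j by move=> z0; rewrite divr_ge0// exprn_ge0.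
have ky0 : 0 <= kappa * y by rewrite mulr_ge0.
have uk j : (J <= j)%N -> u (kappa * y) j <= kappa ^+ J * u y j.
  move=> Jj; rewrite /u exprMn -mulrA ler_wpM2r ?u0//.
  by rewrite -(subnKC Jj) exprD ler_piMr ?exprn_ge0// exprn_ile1.
have split z m : (J <= m)%N ->
    series (u z) m = series (u z) J + \sum_(J <= j < m) u z j.
  by move=> Jm; rewrite /series/= (big_cat_nat _ _ (n := J)).
apply/andP; split.
  apply: (cvgr_to_ge (@series_expR R (kappa * y))); near=> m.
  have Jm : (J <= m)%N by near: m; exact: nbhs_infty_ge.
  rewrite (split _ _ Jm) lerDl sumr_ge0// => j _; exact: u0.
apply: (ler_cvg_to (@series_expR R (kappa * y))
   (cvgD (cvg_cst (series (u (kappa * y)) J)) (cvgM (cvg_cst (kappa ^+ J)) (@series_expR R y)))).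
near=> m.
have Jm : (J <= m)%N by near: m; exact: nbhs_infty_ge.
rewrite (split _ _ Jm) lerD2l.
apply: (@le_trans _ _ (\sum_(J <= j < m) kappa ^+ J * u y j)).
  by rewrite big_nat [leRHS]big_nat ler_sum// => j /andP[Jj _]; exact: uk.
rewrite -mulr_sumr ler_wpM2l ?exprn_ge0// (split y _ Jm) lerDr sumr_ge0// => j _.
exact: u0.
Unshelve. all: by end_near. Qed.

(** A squeeze. For fixed N and J >= N, the first N terms at stage J are at most the whole triangular
    sum, so letting J grow bounds the N-th partial sum of the limit series by [l]; and
    [c N n <= cl n] bounds it below by the N-th triangular sum. *)
Lemma cvg_series_monotone (c : nat -> nat -> R) (b cl : nat -> R) (l : R) :
  (forall n, 0 <= b n) -> (forall J n, 0 <= c J n) ->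
  (forall J n, c J n <= cl n) -> (forall n, c J n @[J --> \oo] --> cl n) ->
  (fun J => \sum_(n < J) b n * c J n) @ \oo --> l ->
  series (fun n => b n * cl n) @ \oo --> l.
Proof.
move=> b0 c0 ccl ccv Sl.
have Tl N : series (fun n => b n * cl n) N <= l.
  have C : \sum_(0 <= n < N) b n * c J n @[J --> \oo] -->
      \sum_(0 <= n < N) b n * cl n.
    elim: N => [|N IH].
      by rewrite big_nil; under eq_fun do rewrite big_nil; exact: cvg_cst.
    rewrite big_nat_recr//=; under eq_fun do rewrite big_nat_recr//=.
    by apply: cvgD IH _; apply: cvgM; [exact: cvg_cst|exact: ccv].
  apply: (ler_cvg_to C Sl); near=> J.
  have NJ : (N <= J)%N by near: J; exact: nbhs_infty_ge.
  rewrite -(big_mkord xpredT (fun n => b n * c J n)) [leRHS](big_cat_nat _ _ (n := N))//=.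
  by rewrite lerDl sumr_ge0// => n _; rewrite mulr_ge0.
apply: (squeeze_cvgr _ Sl (cvg_cst l)); apply: nearW => N; rewrite Tl andbT.
rewrite /series/= big_mkord ler_sum// => n _.
by rewrite ler_wpM2l.
Unshelve. all: by end_near. Qed.

End real_series.

(** * Laguerre coefficients of the Taylor polynomials of e^(tau x) *)

Section exponential_expansion.
Context {R : realType} (s tau : R).
Hypotheses (s_gt0 : 0 < s) (tau_ge0 : 0 <= tau) (tau_lt1 : tau < 1).

Definition exp_taylor (J : nat) : {poly R} :=
  \sum_(j < J) (tau ^+ j / j`!%:R) *: 'X^j.

(** The coefficient of L_n in the Taylor polynomial without its sign (-1)^n. Summing over all j < J,
    with zeros for j < n, makes it a partial sum of a nonnegative series in j. *)
Definition exp_taylor_coef (J n : nat) : R :=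
  \sum_(j < J) if (n <= j)%N then
    tau ^+ j * Gamma (s + j%:R) / (Gamma (s + n%:R) * (j - n)`!%:R) else 0.

Let G0 (k : nat) : Gamma (s + k%:R) != 0.
Proof. by rewrite gt_eqF// GammaDnat_gt0. Qed.

Let F0 (k : nat) : k`!%:R != 0 :> R.
Proof. by rewrite pnatr_eq0 -lt0n fact_gt0. Qed.

Lemma horner_exp_taylor J x :
  (exp_taylor J).[x] = \sum_(j < J) (tau * x) ^+ j / j`!%:R.
Proof.
rewrite horner_sum; apply: eq_bigr => j _.
by rewrite hornerZ hornerXn exprMn mulrAC.
Qed.

Lemma exp_taylor_laguerre J :
  exp_taylor J = \sum_(n < J) ((-1) ^+ n * exp_taylor_coef J n) *: laguerre_poly s n.
Proof.
rewrite /exp_taylor.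
transitivity (\sum_(j < J) \sum_(n < J) (if (n <= j)%N then
    (-1) ^+ n * (tau ^+ j * Gamma (s + j%:R) / (Gamma (s + n%:R) * (j - n)`!%:R))
    else 0) *: laguerre_poly s n).
  apply: eq_bigr => j _; rewrite (Xn_laguerre_poly s_gt0) scaler_sumr.
  rewrite (big_ord_widen J (fun n => (tau ^+ j / j`!%:R) *:
      (((-1) ^+ n * j`!%:R * Gamma (s + j%:R) / (Gamma (s + n%:R) * (j - n)`!%:R)) *: laguerre_poly s n)))//.
  rewrite big_mkcond/=; apply: eq_bigr => n _; rewrite ltnS.
  case: ifP => _; last by rewrite scale0r.
  rewrite scalerA; congr (_ *: _); set u := (-1) ^+ n.
  by field; rewrite !F0 G0.
rewrite exchange_big/=; apply: eq_bigr => n _.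
rewrite -scaler_suml mulr_sumr; congr (_ *: _); apply: eq_bigr => j _.
by case: ifP => // _; rewrite mulr0.
Qed.

Let term_ge0 n j : 0 <= (if (n <= j)%N then
    tau ^+ j * Gamma (s + j%:R) / (Gamma (s + n%:R) * (j - n)`!%:R) else 0).
Proof. by case: ifP => // _; rewrite divr_ge0 ?mulr_ge0 ?exprn_ge0 ?Gamma_ge0. Qed.

Lemma exp_taylor_coef_ge0 J n : 0 <= exp_taylor_coef J n.
Proof. by rewrite sumr_ge0. Qed.

(** After the shift j = m + n this is the binomial series with parameter s + n; it converges for
    every tau < 1, beyond the range tau < 1/2 of the generating function. *)
Lemma exp_taylor_coef_cvg n :
  exp_taylor_coef J n @[J --> \oo] --> tau ^+ n * (1 - tau) `^ (- (s + n%:R)).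
Proof.
pose u j := if (n <= j)%N then
    tau ^+ j * Gamma (s + j%:R) / (Gamma (s + n%:R) * (j - n)`!%:R) else 0.
have -> : exp_taylor_coef^~ n = series u.
  by apply/funext => J; rewrite /series/= big_mkord.
apply/nneseries_EFinP; first exact: term_ge0.
rewrite (nneseries_split 0 n); last by move=> k _; rewrite lee_fin term_ge0.
rewrite add0n big_nat big1 ?add0e; last first.
  by move=> i /andP[_ ik]; rewrite /u leqNgt ik.
rewrite -(nneseries_addn n); last by move=> k; rewrite lee_fin term_ge0.
transitivity (\sum_(0 <= m <oo) (tau ^+ n / Gamma (s + n%:R))%:E *
      (tau ^+ m / m`!%:R * Gamma (s + n%:R + m%:R))%:E)%E.
  apply: eq_eseriesr => m _; rewrite /u leq_addl -EFinM addnK; congr EFin.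
  have -> : s + (m + n)%:R = s + n%:R + m%:R by rewrite natrD; ring.
  by rewrite exprD; field; rewrite G0 !F0.
rewrite nneseriesZl; last first.
  by move=> m _; rewrite lee_fin mulr_ge0 ?Gamma_ge0// divr_ge0// exprn_ge0.
rewrite Gamma_binomial_series ?tau_ge0 ?tau_lt1//; last by rewrite ltr_wpDr.
by rewrite -!EFinM; congr EFin; field; rewrite G0.
Qed.

Lemma exp_taylor_coef_le J n :
  exp_taylor_coef J n <= tau ^+ n * (1 - tau) `^ (- (s + n%:R)).
Proof.
apply: (cvgr_to_ge (@exp_taylor_coef_cvg n)); near=> m.
have Jm : (J <= m)%N by near: m; exact: nbhs_infty_ge.
rewrite /exp_taylor_coef (big_ord_widen m (fun j => if (n <= j)%N then
    tau ^+ j * Gamma (s + j%:R) / (Gamma (s + n%:R) * (j - n)`!%:R) else 0))//.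
rewrite big_mkcond/= ler_sum// => j _.
by case: ifP.
Unshelve. all: by end_near. Qed.

End exponential_expansion.

(** * The multiplier on polynomials and the pairing with exponentials *)

Section spectral_multiplier.
Context {R : realType} (alpha : R).
Hypothesis halpha : -1 < alpha.
Local Notation mu := (gamma_measure alpha).
Local Notation s := (alpha + 1).

Let s_gt0 : 0 < s. Proof. by rewrite -ltrBlDr sub0r. Qed.

Lemma Lfun_poly (P : {poly R}) (r : R) : 0 < r -> horner P \in Lfun mu r%:E.
Proof.
move=> r0; have e0 : 0 < (2 * r)^-1 by rewrite invr_gt0 mulr_gt0.
have [C C0 HC] := poly_le_exp P e0.
apply: (Lfun_le_exp halpha (measurable_poly P (A := setT)) C0 HC r0).
have -> : r * (2 * r)^-1 = 2^-1 by field; rewrite gt_eqF.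
lra.
Qed.

Lemma Lfun_exp_fun (tau r : R) : 0 < r -> r * tau < 1 -> exp_fun tau \in Lfun mu r%:E.
Proof.
move=> r0 rt; have mE : measurable_fun [set: R] (exp_fun tau) by exact: measurable_exp_fun.
apply: (Lfun_le_exp halpha mE ler01 _ r0 rt).
by move=> x _; rewrite mul1r ger0_norm ?expR_ge0.
Qed.

Lemma Lnorm_exp_fun (tau r : R) : 0 < r -> r * tau < 1 ->
  ('N[mu]_r%:E[EFin \o exp_fun tau] <= ((1 - r * tau) `^ (- (s / r)))%:E)%E.
Proof.
move=> r0 rt; rewrite -[X in (_ <= X%:E)%E]mul1r.
have mE : measurable_fun [set: R] (exp_fun tau) by exact: measurable_exp_fun.
apply: (Lnorm_le_exp halpha mE ler01 _ r0 rt).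
by move=> x _; rewrite mul1r ger0_norm ?expR_ge0.
Qed.

Variables (L : nat -> {poly R}) (a : nat -> R) (A0 : (R -> R) -> R -> R).
Hypothesis hL : is_laguerre alpha L.
Hypothesis hA0 : spectral_multiplier alpha L a A0.

(** The spectral hypothesis concerns the normalized functions; their positive constant is divided
    out by the almost-everywhere homogeneity of [A0]. *)
Lemma multiplier_laguerre n :
  A0 (horner (laguerre_poly s n)) =
  (fun x => a n * (laguerre_poly s n).[x]) %[ae mu].
Proof.
have Ln : L n = laguerre_poly s n.
  by apply: is_laguerreE => //; rewrite addrK.
have [bA0 /(_ n) An] := hA0.
set k := Num.sqrt (n`!%:R * Gamma (alpha + 1) / Gamma (n%:R + alpha + 1)).
have k0 : 0 < k.
  rewrite sqrtr_gt0 divr_gt0 ?mulr_gt0 ?ltr0n ?fact_gt0 ?Gamma_gt0//.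
  by rewrite -addrA ltr_wpDl.
have lP : laguerre_normalized alpha L n = horner (k *: laguerre_poly s n).
  by apply/funext => x; rewrite /laguerre_normalized -/k Ln hornerZ.
have l2 : laguerre_normalized alpha L n \in Lfun mu 2%:E by rewrite lP Lfun_poly.
have := @operator_scale _ _ _ mu 2 2 A0 _ bA0 k^-1 _ l2.
have -> : (fun x => k^-1 * laguerre_normalized alpha L n x) = horner (laguerre_poly s n).
  by apply/funext => x; rewrite lP hornerZ mulKf// gt_eqF.
move=> /(_ (ler1n _ 2)).
move: An; apply: (@filterS2 _ _ (ae_filter_ringOfSetsType mu)) => x An Ak _.
rewrite (Ak I) (An I) lP hornerZ.
by field; rewrite gt_eqF.
Qed.

Lemma multiplier_laguerre_sum (c : nat -> R) J :
  A0 (horner (\sum_(n < J) c n *: laguerre_poly s n)) =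
  horner (\sum_(n < J) (c n * a n) *: laguerre_poly s n) %[ae mu].
Proof.
have [bA0 _] := hA0; have le12 : 1 <= 2 :> R by rewrite ler1n.
elim: J => [|J IH].
  rewrite !big_ord0.
  have -> : horner 0 = (fun=> 0) :> (R -> R) by apply/funext => x; rewrite horner0.
  exact: (operator0 le12 bA0).
have lin := operator_linear bA0 (c J) (Lfun_poly (laguerre_poly s J) (ltr0n _ 2))
  (Lfun_poly (\sum_(n < J) c n *: laguerre_poly s n) (ltr0n _ 2)).
have E : horner (\sum_(n < J.+1) c n *: laguerre_poly s n) =
   (fun x => c J * (laguerre_poly s J).[x] + (\sum_(n < J) c n *: laguerre_poly s n).[x]).
  by apply/funext => x; rewrite big_ord_recr/= hornerD hornerZ addrC.
rewrite -E in lin.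
move: (multiplier_laguerre J) lin IH.
apply: (@filterS3 _ _ (ae_filter_ringOfSetsType mu)) => x h1 h2 h3 _.
by rewrite (h2 I) (h1 I) (h3 I) big_ord_recr/= hornerD hornerZ addrC mulrA.
Qed.

Variables (p q : R) (A : (R -> R) -> R -> R).
Hypotheses (p_gt1 : 1 < p) (q_gt1 : 1 < q).
Hypothesis hA : bounded_operator mu p q A.
Hypothesis hext : extends_to_Lp alpha p A0 A.
Local Notation q' := (q / (q - 1)).

Let p_gt0 : 0 < p. Proof. exact: lt_trans p_gt1. Qed.
Let q_gt0 : 0 < q. Proof. exact: lt_trans q_gt1. Qed.
Let q'_gt0 : 0 < q'. Proof. by rewrite divr_gt0// subr_gt0. Qed.
Let q_conj : q^-1 + q'^-1 = 1.
Proof. by field; rewrite !gt_eqF// subr_gt0. Qed.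

(** Polynomials belong to both L^2 and L^p, so the extension acts on them as the L^2 multiplier
    does. *)
Lemma extension_laguerre_sum (c : nat -> R) J :
  A (horner (\sum_(n < J) c n *: laguerre_poly s n)) =
  horner (\sum_(n < J) (c n * a n) *: laguerre_poly s n) %[ae mu].
Proof.
move: (multiplier_laguerre_sum c J)
  (hext (Lfun_poly (\sum_(n < J) c n *: laguerre_poly s n) (ltr0n _ 2))
        (Lfun_poly (\sum_(n < J) c n *: laguerre_poly s n) p_gt0)).
apply: (@filterS2 _ _ (ae_filter_ringOfSetsType mu)) => x h1 h2 _.
by rewrite (h2 I) (h1 I).
Qed.

Section pairing.
Variables (tau1 tau2 : R).
Hypotheses (tau1_gt0 : 0 < tau1) (tau1_lt : p * tau1 < 1).
Hypotheses (tau2_gt0 : 0 < tau2) (tau2_lt : q' * tau2 < 1).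

Definition pairing (f : R -> R) : \bar R :=
  (\int[mu]_x (A f x * exp_fun tau2 x)%:E)%E.

Let tau1_lt1 : tau1 < 1.
Proof. by apply: le_lt_trans tau1_lt; rewrite ler_peMl// ltW. Qed.

Let tau2_lt1 : tau2 < 1.
Proof.
apply: le_lt_trans tau2_lt; rewrite ler_peMl// ?(ltW tau2_gt0)//.
by rewrite ler_pdivlMr ?subr_gt0// mul1r gerBl.
Qed.

Let g2_Lfun : exp_fun tau2 \in Lfun mu q'%:E.
Proof. exact: Lfun_exp_fun. Qed.

Lemma pairing_integrable f : f \in Lfun mu p%:E ->
  mu.-integrable [set: R] (fun x => (A f x * exp_fun tau2 x)%:E).
Proof.
move=> fp; exact: (hoelder_integrable q_gt0 q'_gt0 q_conj (operator_Lfun hA fp) g2_Lfun).1.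
Qed.

Lemma pairing_le f K : f \in Lfun mu p%:E -> 0 < K ->
  ('N[mu]_p%:E[EFin \o f] <= K%:E)%E ->
  (`|pairing f| <= operator_norm mu p q A * K%:E * ((1 - q' * tau2) `^ (- (s / q')))%:E)%E.
Proof.
move=> fp K0 fK.
have [_ H] := hoelder_integrable q_gt0 q'_gt0 q_conj (operator_Lfun hA fp) g2_Lfun.
apply: (le_trans H); apply: lee_pmul; rewrite ?Lnorm_ge0//.
  exact: le_operator_norm (ltW p_gt1) (ltW q_gt1) hA _ _ fp K0 fK.
exact: Lnorm_exp_fun.
Qed.

Lemma pairing_add f g : f \in Lfun mu p%:E -> g \in Lfun mu p%:E ->
  pairing (fun x => f x + g x) = (pairing f + pairing g)%E.
Proof.
move=> fp gp.
have fgp : (fun x => f x + g x) \in Lfun mu p%:E.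
  have := Lfun_linear 1 (ltW p_gt1) fp gp.
  by under eq_fun do rewrite mul1r.
rewrite /pairing -integralD//; [|exact: pairing_integrable..].
apply: ae_eq_integral => //.
- exact: measurable_int (pairing_integrable fgp).
- by apply: emeasurable_funD; apply: measurable_int; exact: pairing_integrable.
have := operator_linear hA 1 fp gp.
have -> : (fun x => 1 * f x + g x) = (fun x => f x + g x).
  by apply/funext => x; rewrite mul1r.
apply: (@filterS _ _ (ae_filter_ringOfSetsType mu)) => x h _.
by rewrite (h I) mul1r mulrDl EFinD.
Qed.

Definition exp_laguerre_coef (tau : R) (n : nat) : R :=
  tau ^+ n * (1 - tau) `^ (- (s + n%:R)).

(** The integral of L_n against e^(tau x) without its sign (-1)^n. *)
Definition laguerre_exp_integral (tau : R) (n : nat) : R :=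
  Gamma (s + n%:R) / (n`!%:R * Gamma s) * (1 - tau) `^ (- s) * (tau / (1 - tau)) ^+ n.

Lemma pairing_taylor J :
  pairing (horner (exp_taylor tau1 J)) =
  (\sum_(n < J) a n * laguerre_exp_integral tau2 n * exp_taylor_coef s tau1 J n)%:E.
Proof.
rewrite (@exp_taylor_laguerre R s tau1 s_gt0 J) /pairing.
set c := fun n => (-1) ^+ n * exp_taylor_coef s tau1 J n.
transitivity (\int[mu]_x (\sum_(n < J) (c n * a n)%:E *
    ((laguerre_poly s n).[x] * expR (tau2 * x))%:E))%E.
  have iP := integrable_poly_exp halpha (\sum_(n < J) (c n * a n) *: laguerre_poly s n) tau2_lt1.
  have E : (fun x => \sum_(n < J) (c n * a n)%:E *
      ((laguerre_poly s n).[x] * expR (tau2 * x))%:E)%E =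
     (fun x => ((\sum_(n < J) (c n * a n) *: laguerre_poly s n).[x] * expR (tau2 * x))%:E).
    apply/funext => x; rewrite horner_sum mulr_suml -sumEFin; apply: eq_bigr => n _.
    by rewrite hornerZ -mulrA EFinM.
  rewrite E; apply: ae_eq_integral => //.
  - by apply: measurable_int; apply: pairing_integrable; exact: Lfun_poly.
  - exact: measurable_int iP.
  have := extension_laguerre_sum c J.
  by apply: (@filterS _ _ (ae_filter_ringOfSetsType mu)) => x h _; rewrite (h I).
rewrite integral_sum//; last by move=> n; apply: integrableZl => //; exact: integrable_poly_exp.
rewrite -sumEFin; apply: eq_bigr => n _.
rewrite integralZl//; last exact: integrable_poly_exp.
rewrite integral_laguerre_poly_exp// -EFinM; congr EFin.
rewrite /c /laguerre_exp_integral (exprNn (tau2 / (1 - tau2))).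
have uu : (-1) ^+ n * (-1) ^+ n = 1 :> R by rewrite -expr2 sqrr_sign.
rewrite -[RHS]mul1r -[X in _ = X * _]uu; set u := (-1) ^+ n.
by ring.
Qed.

Lemma exp_taylor_Lnorm_le : exists2 K : R, 0 < K & exists2 k : R, 0 < k < 1 &
  forall J, ('N[mu]_p%:E[EFin \o (fun x => (exp_fun tau1 x - (exp_taylor tau1 J).[x])%R)] <=
    (k ^+ J * K)%:E)%E.
Proof.
(* The midpoint between tau1 and 1/p: above tau1, so that tau1 / tau < 1, and below 1/p, so that
   e^(tau x) is in L^p. *)
pose tau := (tau1 + p^-1) / 2.
have tau_gt : tau1 < tau.
  have : tau1 < p^-1 by rewrite -(ltr_pM2l p_gt0) divff ?gt_eqF.
  by rewrite /tau; lra.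
have ptau : p * tau < 1.
  have -> : p * tau = (p * tau1 + 1) / 2 by rewrite /tau; field; rewrite gt_eqF.
  by rewrite ltr_pdivrMr// mul1r ltrD2r.
have tau_gt0 : 0 < tau by exact: lt_trans tau_gt.
have k01 : 0 <= tau1 / tau <= 1.
  by rewrite divr_ge0 ?(ltW tau_gt0) ?(ltW tau1_gt0)//= ler_pdivrMr// mul1r ltW.
exists ((1 - p * tau) `^ (- (s / p))); first by rewrite powR_gt0// subr_gt0.
exists (tau1 / tau).
  by rewrite divr_gt0//= ltr_pdivrMr// mul1r.
move=> J; apply: Lnorm_le_exp => //.
- apply: measurable_funB; first exact: measurable_exp_fun.
  exact: measurable_poly.
- by rewrite exprn_ge0//; case/andP: k01.
move=> x x0; have y0 : 0 <= tau * x by rewrite mulr_ge0// ltW.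
have := expR_taylor_bounds J k01 y0.
have -> : tau1 / tau * (tau * x) = tau1 * x by field; rewrite gt_eqF.
rewrite horner_exp_taylor /exp_fun => /andP[h1 h2].
by rewrite ger0_norm ?subr_ge0// lerBlDl.
Qed.

Lemma pairing_exp_cvg :
  (fun J => \sum_(n < J) a n * laguerre_exp_integral tau2 n * exp_taylor_coef s tau1 J n)
    @ \oo --> fine (pairing (exp_fun tau1)).
Proof.
have g1p : exp_fun tau1 \in Lfun mu p%:E by exact: Lfun_exp_fun.
have [K K0 [k /andP[k0 k1] HK]] := exp_taylor_Lnorm_le.
have pfin f : f \in Lfun mu p%:E -> pairing f \is a fin_num.
  by move=> fp; apply: integrable_fin_num => //; exact: pairing_integrable.
have split J : fine (pairing (exp_fun tau1)) -
    \sum_(n < J) a n * laguerre_exp_integral tau2 n * exp_taylor_coef s tau1 J n =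
    fine (pairing (fun x => exp_fun tau1 x - (exp_taylor tau1 J).[x])).
  have Pp := Lfun_poly (exp_taylor tau1 J) p_gt0.
  have dp : (fun x => exp_fun tau1 x - (exp_taylor tau1 J).[x]) \in Lfun mu p%:E.
    have := Lfun_linear (-1) (ltW p_gt1) Pp g1p.
    by under eq_fun do rewrite mulN1r addrC.
  have := pairing_add dp Pp; rewrite pairing_taylor.
  have -> : (fun x => exp_fun tau1 x - (exp_taylor tau1 J).[x] + (exp_taylor tau1 J).[x]) =
      exp_fun tau1 by apply/funext => x; rewrite subrK.
  by move=> ->; rewrite fineD ?pfin//= addrK.
have Nfin : operator_norm mu p q A \is a fin_num.
  by rewrite ge0_fin_numE ?(operator_norm_lty hA)// (operator_norm_ge0 _ _ _ (ltW p_gt1)).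
(* Operator norm, L^p error constant and Hoelder factor of g_tau2: the pairing inherits the
   geometric rate k^J. *)
pose N := fine (operator_norm mu p q A) * K * (1 - q' * tau2) `^ (- (s / q')).
have bound J : `|fine (pairing (exp_fun tau1)) -
    \sum_(n < J) a n * laguerre_exp_integral tau2 n * exp_taylor_coef s tau1 J n| <= N * k ^+ J.
  have dp : (fun x => exp_fun tau1 x - (exp_taylor tau1 J).[x]) \in Lfun mu p%:E.
    have := Lfun_linear (-1) (ltW p_gt1) (Lfun_poly (exp_taylor tau1 J) p_gt0) g1p.
    by under eq_fun do rewrite mulN1r addrC.
  have := pairing_le dp (mulr_gt0 (exprn_gt0 J k0) K0) (HK J).
  rewrite split -(fineK (pfin _ dp)) -(fineK Nfin) -!EFinM /= lee_fin.
  by move/le_trans; apply; rewrite /N le_eqVlt; apply/orP; left; apply/eqP; ring.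
have : fine (pairing (exp_fun tau1)) -
    \sum_(n < J) a n * laguerre_exp_integral tau2 n * exp_taylor_coef s tau1 J n
    @[J --> \oo] --> (0 : R).
  apply/norm_cvg0P; apply: (@squeeze_cvgr _ _ _ _ (fun=> 0) (fun J => N * k ^+ J)).
  - by apply: nearW => J; rewrite normr_ge0 bound.
  - exact: cvg_cst.
  - rewrite -[X in _ --> X](mulr0 N); apply: cvgM; first exact: cvg_cst.
    by apply: cvg_expr; rewrite ger0_norm// ltW.
move=> H; have H' := cvgB (cvg_cst (fine (pairing (exp_fun tau1)))) H.
rewrite subr0 in H'.
set S := (X in X @ \oo --> _).
have -> : S = cst (fine (pairing (exp_fun tau1))) - (fun J => fine (pairing (exp_fun tau1)) - S J).
  by apply/funext => J; rewrite fctE subKr.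
exact: H'.
Qed.

Hypothesis a_ge0 : forall n, 0 <= a n.

Let r0 (tau : R) : 0 < tau -> tau < 1 -> 0 <= tau / (1 - tau).
Proof. by move=> t0 t1; rewrite divr_ge0 ?subr_ge0 ?ltW. Qed.

Lemma laguerre_exp_integral_ge0 n : 0 <= laguerre_exp_integral tau2 n.
Proof.
by rewrite /laguerre_exp_integral !mulr_ge0 ?invr_ge0 ?mulr_ge0 ?Gamma_ge0 ?powR_ge0 ?exprn_ge0 ?r0.
Qed.

(** Here a_n >= 0 enters: it makes the terms nonnegative, so that the limit in J can be taken term
    by term. *)
Lemma pairing_series :
  series (fun n => a n * laguerre_exp_integral tau2 n * exp_laguerre_coef tau1 n) @ \oo -->
  fine (pairing (exp_fun tau1)).
Proof.
have t0 := ltW tau1_gt0.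
apply: (cvg_series_monotone _ _ _ _ pairing_exp_cvg) => [n|J n|J n|n].
- by rewrite mulr_ge0 ?laguerre_exp_integral_ge0.
- exact: exp_taylor_coef_ge0.
- exact: exp_taylor_coef_le.
- exact: exp_taylor_coef_cvg.
Qed.

Definition pairing_term (n : nat) : R :=
  a n * (Gamma (s + n%:R) / (Gamma s * n`!%:R)) * varrho tau1 tau2 ^+ n.

Lemma varrho_ge0 : 0 <= varrho tau1 tau2.
Proof.
by rewrite /varrho divr_ge0 ?mulr_ge0 ?subr_ge0 ?ltW.
Qed.

Lemma pairing_term_ge0 n : 0 <= pairing_term n.
Proof.
by rewrite /pairing_term !mulr_ge0 ?invr_ge0 ?mulr_ge0 ?Gamma_ge0 ?exprn_ge0 ?varrho_ge0.
Qed.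

Lemma sum_pairing_term :
  (\sum_(0 <= n <oo) (pairing_term n)%:E =
   (a 0%N)%:E + \sum_(1 <= n <oo)
     (a n * (Gamma (n%:R + alpha + 1) / (Gamma (alpha + 1) * n`!%:R)) *
      varrho tau1 tau2 ^+ n)%:E)%E.
Proof.
apply: nneseries_recl => [n||n]; first by rewrite lee_fin pairing_term_ge0.
- have s0E : alpha + 1 + 0%:R = alpha + 1 by exact: addr0.
  rewrite /pairing_term expr0 mulr1 fact0 mulr1 s0E divff ?mulr1//.
  by rewrite gt_eqF// Gamma_gt0.
- have nE : n%:R + alpha + 1 = alpha + 1 + n%:R by rewrite -addrA addrC.
  by rewrite nE.
Qed.

Lemma pairing_fin_num : pairing (exp_fun tau1) \is a fin_num.
Proof. by apply: integrable_fin_num => //; apply: pairing_integrable; exact: Lfun_exp_fun. Qed.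

Lemma pairingE :
  pairing (exp_fun tau1) =
  (((1 - tau1) `^ (- s) * (1 - tau2) `^ (- s))%:E *
    \sum_(0 <= n <oo) (pairing_term n)%:E)%E.
Proof.
have t1 : 0 < 1 - tau1 by rewrite subr_gt0.
have t2 : 0 < 1 - tau2 by rewrite subr_gt0.
rewrite -(fineK pairing_fin_num).
have u0 n : 0 <= a n * laguerre_exp_integral tau2 n * exp_laguerre_coef tau1 n.
  rewrite mulr_ge0//; first by rewrite mulr_ge0 ?laguerre_exp_integral_ge0.
  by rewrite mulr_ge0 ?powR_ge0 ?exprn_ge0// ltW.
rewrite -((nneseries_EFinP _ u0).1 pairing_series) -nneseriesZl; last first.
  by move=> n _; rewrite lee_fin pairing_term_ge0.
apply: eq_eseriesr => n _; rewrite -EFinM; congr EFin.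
rewrite /laguerre_exp_integral /exp_laguerre_coef /pairing_term /varrho.
have -> : (1 - tau1) `^ (- (s + n%:R)) = (1 - tau1) `^ (- s) / (1 - tau1) ^+ n.
  rewrite opprD powRD; last by apply/implyP => _; rewrite gt_eqF.
  by rewrite powR_invn// ltW.
rewrite !expr_div_n !exprMn; field.
by rewrite !expf_neq0 ?gt_eqF ?Gamma_gt0 ?ltr0n ?fact_gt0.
Qed.

Lemma pairing_term_le n :
  (((1 - tau1) `^ (- s) * (1 - tau2) `^ (- s) * pairing_term n)%:E <=
   operator_norm mu p q A *
     ((1 - p * tau1) `^ (- (s / p)) * (1 - q' * tau2) `^ (- (s / q')))%:E)%E.
Proof.
have g1p : exp_fun tau1 \in Lfun mu p%:E by exact: Lfun_exp_fun.
have K0 : 0 < (1 - p * tau1) `^ (- (s / p)) by rewrite powR_gt0// subr_gt0.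
have := pairing_le g1p K0 (Lnorm_exp_fun p_gt0 tau1_lt).
rewrite -muleA -EFinM; apply: le_trans.
apply: (@le_trans _ _ (pairing (exp_fun tau1))); last exact: lee_abs.
rewrite pairingE EFinM lee_wpmul2l ?lee_fin ?mulr_ge0 ?powR_ge0//.
have := @nneseries_lim_ge R (fun n => (pairing_term n)%:E) xpredT 0 n.+1.
rewrite big_nat_recr//= => H; apply: le_trans (H _); last first.
  by move=> k _ _; rewrite lee_fin pairing_term_ge0.
by rewrite leeDr// sume_ge0// => k _; rewrite lee_fin pairing_term_ge0.
Qed.

End pairing.
End spectral_multiplier.

(** * Choice of tau1 and tau2 for each n, and the resulting constant *)

Section constants.
Context {R : realType}.
Implicit Types (s p q tau : R) (n : nat).

(* The ratio [tau / (1 - tau)] tends to [(p - 1)^-1] as [p * tau] tends to 1;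
   at [p * tau = 1 - (n + 2)^-1] its n-th power loses only a bounded factor. *)
Lemma near_critical_ratio p n : 1 < p -> let tau := (1 - n.+2%:R^-1) / p in
  [/\ 0 < tau, p * tau = 1 - n.+2%:R^-1, tau < 1 &
    1 <= expR ((p - 1)^-1 + 1) * ((p - 1) * (tau / (1 - tau))) ^+ n].
Proof.
move=> p1 tau.
have p0 : 0 < p by lra.
have pp : 0 < p - 1 by rewrite subr_gt0.
pose N : R := n.+1%:R; have N0 : 0 < N by rewrite ltr0n.
have N1 : 0 < N + 1 by rewrite addr_gt0.
have n2E : n.+2%:R = N + 1 :> R by rewrite -natr1.
have tauE : tau = N / ((N + 1) * p).
  by rewrite /tau n2E; field; rewrite !gt_eqF.
have tau0 : 0 < tau by rewrite tauE divr_gt0// mulr_gt0.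
have ptau : p * tau = 1 - n.+2%:R^-1 by rewrite /tau mulrC divfK// gt_eqF.
have tau1 : tau < 1.
  rewrite -(ltr_pM2l p0) ptau mulr1; apply: lt_trans p1.
  by rewrite gtrBl invr_gt0.
split => //.
set z := (p - 1) * _.
(* Each factor of z^-1 is 1 + O(1/N) with N = n + 1, hence below an exponential with exponent
   O(1/N); its n-th power stays bounded because n <= N. *)
have zE : z = ((1 + (N + 1)^-1 / (p - 1)) * (1 + N^-1))^-1.
  pose D := (N + 1) * (p - 1) + 1.
  have D0 : 0 < D by rewrite /D addr_gt0// mulr_gt0.
  have -> : z = (p - 1) * (N / D).
    rewrite /z tauE; congr (_ * _).
    have -> : 1 - N / ((N + 1) * p) = D / ((N + 1) * p).
      by rewrite /D; field; rewrite !gt_eqF.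
    by field; rewrite !gt_eqF.
  have -> : (1 + (N + 1)^-1 / (p - 1)) * (1 + N^-1) = D / (N * (p - 1)).
    by rewrite /D; field; rewrite !gt_eqF.
  by rewrite invf_div mulrA (mulrC N).
have le_exp : (1 + (N + 1)^-1 / (p - 1)) * (1 + N^-1) <=
    expR (((p - 1)^-1 + 1) * N^-1).
  have -> : ((p - 1)^-1 + 1) * N^-1 = (p - 1)^-1 * N^-1 + N^-1 by rewrite mulrDl mul1r.
  have i0 : 0 <= N^-1 by rewrite invr_ge0 ltW.
  have j0 : 0 <= (N + 1)^-1 / (p - 1) by rewrite divr_ge0 ?invr_ge0 ?(ltW N1) ?(ltW pp).
  rewrite expRD; apply: ler_pM; rewrite ?addr_ge0//.
    apply: (le_trans (expR_ge1Dx _)); rewrite ler_expR mulrC ler_wpM2l ?invr_ge0 ?(ltW pp)//.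
    by rewrite lef_pV2 ?posrE// lerDl.
  exact: expR_ge1Dx.
have z0 : 0 < z by rewrite /z mulr_gt0// divr_gt0// subr_gt0.
have : (z^-1) ^+ n <= expR ((p - 1)^-1 + 1).
  have e0 : 0 <= (p - 1)^-1 + 1 by rewrite addr_ge0// invr_ge0 ltW.
  apply: (@le_trans _ _ (expR (((p - 1)^-1 + 1) * N^-1) ^+ n)).
    rewrite lerXn2r ?nnegrE ?expR_ge0 ?invr_ge0 ?(ltW z0)//.
    by rewrite zE invrK.
  rewrite -expRM_natl ler_expR mulrCA ler_piMr//.
  by rewrite ler_pdivrMr// mul1r ler_nat.
by rewrite exprVn -[X in X <= _]div1r ler_pdivrMr// exprn_gt0.
Qed.

(** The Hoelder bound is compared with the weight of a_n in the pairing. With 1 - p tau1 = 1 - q'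
    tau2 = 1/(n + 2) the bound is (n + 2)^k, k = s/p + s/q', while Gamma (s + n) / n! is at least a
    multiple of (n + 1)^(s - 1); the exponents combine to k + 1 - s = s (1/p - 1/q) + 1. *)
Lemma coefficient_constants s p q : 0 < s -> 1 < p -> 1 < q ->
  let q' := q / (q - 1) in
  exists2 C : R, 0 < C & forall n, exists tau1 tau2,
   [/\ 0 < tau1 /\ p * tau1 < 1, 0 < tau2 /\ q' * tau2 < 1 &
    (1 - p * tau1) `^ (- (s / p)) * (1 - q' * tau2) `^ (- (s / q')) <=
    C * (((p - 1) / (q - 1)) ^+ n * n.+1%:R `^ (s * (p^-1 - q^-1) + 1)) *
     ((1 - tau1) `^ (- s) * (1 - tau2) `^ (- s) *
       (Gamma (s + n%:R) / (Gamma s * n`!%:R) * varrho tau1 tau2 ^+ n))].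
Proof.
move=> s0 p1 q1 q'.
have p0 : 0 < p by lra.
have pp : 0 < p - 1 by rewrite subr_gt0.
have qp : 0 < q - 1 by rewrite subr_gt0.
have q0 : 0 < q by lra.
have q'1 : 1 < q' by rewrite ltr_pdivlMr// mul1r gtrBl.
have q'0 : 0 < q' by lra.
have q'p : q' - 1 = (q - 1)^-1 by rewrite /q'; field; rewrite gt_eqF.
pose k := s / p + s / q'.
have k0 : 0 <= k by rewrite addr_ge0// divr_ge0// ltW.
have [C1 C10 HC1] := fact_le_GammaDnat s0.
pose E := expR ((p - 1)^-1 + 1) * expR ((q' - 1)^-1 + 1).
have E0 : 0 < E by rewrite mulr_gt0 ?expR_gt0.
have Gs : 0 < Gamma s by exact: Gamma_gt0.
(* [2 ^ k] comes from n + 2 <= 2 (n + 1), [C1] from the growth of Gamma (s + n), [Gamma s] from the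
   normalization of the weight, and [E] from the two near-critical n-th powers. *)
exists (2 `^ k * C1 * Gamma s * E);
  first by rewrite (mulr_gt0 (mulr_gt0 (mulr_gt0 (powR_gt0 _ _) C10) Gs) E0).
move=> n; have := near_critical_ratio n p1; have := near_critical_ratio n q'1.
set t2 := (_ / q'); set t1 := (_ / p).
move=> [t20 qt2 t21 H2] [t10 pt1 t11 H1].
have dlt : 1 - n.+2%:R^-1 < 1 :> R by rewrite gtrBl invr_gt0.
exists t1, t2; split; [by rewrite pt1|by rewrite qt2|].
rewrite pt1 qt2 opprB addrC subrK.
pose N : R := n.+1%:R; have N0 : 0 < N by rewrite ltr0n.
have W1 t : 0 < t -> t < 1 -> 1 <= (1 - t) `^ (- s).
  move=> t0 tlt; rewrite powRN invf_ge1 ?powR_gt0 ?subr_gt0//.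
  rewrite -[leRHS](powRr0 (1 - t)) ger_powR ?(ltW s0)// subr_gt0 tlt/=.
  by rewrite gerBl ltW.
have h1 : n.+2%:R^-1 `^ (- (s / p)) * n.+2%:R^-1 `^ (- (s / q')) <= 2 `^ k * N `^ k.
  rewrite -powRD; last by apply/implyP => _; rewrite invr_eq0 pnatr_eq0.
  have -> : n.+2%:R^-1 `^ (- (s / p) - s / q') = n.+2%:R `^ k :> R.
    by rewrite -opprD -/k -[n.+2%:R^-1]powR_inv1// -powRrM mulN1r opprK.
  rewrite -powRM ?(ltW N0)//.
  have := @ge0_ler_powR R k k0 n.+2%:R (2 * N); rewrite !nnegrE; apply => //.
    by rewrite mulr_ge0// ltW.
  by rewrite /N -natrM ler_nat mul2n -addnn addnS ltnS leq_addr.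
have h2 : 1 <= C1 * N `^ (1 - s) * (Gamma (s + n%:R) / n`!%:R).
  by rewrite mulrA ler_pdivlMr ?ltr0n ?fact_gt0// mul1r HC1.
have h3 : 1 <= E * (((p - 1) / (q - 1)) ^+ n * varrho t1 t2 ^+ n).
  have -> : E * (((p - 1) / (q - 1)) ^+ n * varrho t1 t2 ^+ n) =
    (expR ((p - 1)^-1 + 1) * ((p - 1) * (t1 / (1 - t1))) ^+ n) *
    (expR ((q' - 1)^-1 + 1) * ((q' - 1) * (t2 / (1 - t2))) ^+ n).
    rewrite [RHS]mulrACA -/E -!exprMn; congr (_ * _ ^+ _).
    by rewrite /varrho q'p; field; rewrite !gt_eqF// subr_gt0.
  by rewrite mulr_ege1.
have h4 := mulr_ege1 (W1 _ t10 t11) (W1 _ t20 t21).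
have NE : N `^ (s * (p^-1 - q^-1) + 1) = N `^ k * N `^ (1 - s).
  rewrite -powRD; last by apply/implyP => _; rewrite gt_eqF.
  by congr (_ `^ _); rewrite /k /q'; field; rewrite !gt_eqF.
rewrite -/N NE (le_trans h1)//.
have h := mulr_ege1 (mulr_ege1 h2 h3) h4.
have X0 : 0 <= 2 `^ k * N `^ k by rewrite mulr_ge0 ?powR_ge0.
have := ler_peMr X0 h; move/le_trans; apply; rewrite le_eqVlt; apply/orP; left; apply/eqP.
set w1 := (1 - t1) `^ _; set w2 := (1 - t2) `^ _.
set v := varrho _ _ ^+ n; set th := ((p - 1) / (q - 1)) ^+ n.
by field; rewrite !gt_eqF ?ltr0n ?fact_gt0.
Qed.

End constants.

(** * The limsup of n-th roots under a geometric bound with a power correction *)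

Section root_test.
Context {R : realType}.

Lemma limn_esup_le (u v : nat -> R) (l : R) (N : nat) :
  (forall n, (N <= n)%N -> u n <= v n) -> v @ \oo --> l ->
  (limn_esup (fun n => (u n)%:E) <= l%:E)%E.
Proof.
move=> uv vl; apply/lee_addgt0Pr => e e0.
rewrite limn_esup_lim.
have [M _ HM] : \forall n \near \oo, v n <= l + e.
  by move/cvgr_le : vl; apply; rewrite ltrDl.
apply: lime_le; first exact: is_cvg_esups.
near=> n; apply: ub_ereal_sup => _ [k /= nk <-]; rewrite -EFinD lee_fin.
have Mn : (maxn M N <= n)%N by near: n; exact: nbhs_infty_ge.
move: Mn; rewrite geq_max => /andP[Mn Nn].
by rewrite (le_trans (uv _ _)) ?HM//= (leq_trans _ nk).
Unshelve. all: by end_near. Qed.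

Lemma limn_esup_root_le (a : nat -> R) (B theta kappa : R) :
  0 < B -> 0 < theta -> (forall n, 0 <= a n) ->
  (forall n, a n <= B * (theta ^+ n * n.+1%:R `^ kappa)) ->
  (limn_esup (fun n => (a n `^ (n%:R)^-1)%:E) <= theta%:E)%E.
Proof.
move=> B0 th0 a0 aB.
(* With h = sqrt (n + 1), ln (n + 1) <= 2 h and h^2 <= 2 n bound (ln B + kappa ln (n + 1)) / n by D
   / h. *)
pose D := 2 * `|ln B| + 4 * `|kappa|.
(* The comparison starts at n = 1: at n = 0 the exponent 0^-1 is 0 and the term is 1 whatever a_0
   is. *)
apply: (@limn_esup_le _ (fun n => theta * expR (D * Num.sqrt (harmonic n))) _ 1).
  move=> n n1; have n0 : 0 < n%:R :> R by rewrite ltr0n.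
  pose N : R := n.+1%:R; have N0 : 0 < N by rewrite ltr0n.
  have rhs0 : 0 < B * (theta ^+ n * N `^ kappa).
    by rewrite !mulr_gt0 ?exprn_gt0 ?powR_gt0.
  have lnE : ln (B * (theta ^+ n * N `^ kappa)) = ln B + (n%:R * ln theta + kappa * ln N).
    rewrite !lnM ?posrE ?mulr_gt0 ?exprn_gt0 ?powR_gt0//.
    by rewrite lnXn// ln_powR mulr_natl.
  apply: (@le_trans _ _ ((B * (theta ^+ n * N `^ kappa)) `^ n%:R^-1)).
    have i0 : 0 <= n%:R^-1 :> R by rewrite invr_ge0.
    by apply: (ge0_ler_powR i0); rewrite ?nnegrE ?(ltW rhs0)//; exact: aB.
  rewrite -[X in X `^ _](lnK (x := _)) ?posrE// -expRM lnE.
  rewrite -[X in _ <= X * _](lnK (x := _)) ?posrE// -expRD ler_expR.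
  have -> : (ln B + (n%:R * ln theta + kappa * ln N)) / n%:R =
     ln theta + (ln B + kappa * ln N) / n%:R by field; rewrite gt_eqF.
  rewrite lerD2l ler_pdivrMr// /harmonic sqrtrV ?(ltW N0)// -/N.
  set h := Num.sqrt N.
  have h1 : 1 <= h by rewrite -(@sqrtr1 R) ler_sqrt// ler1n.
  have h0 : 0 < h by exact: lt_le_trans h1.
  have hN : N = h ^+ 2 by rewrite sqr_sqrtr// ltW.
  have lnN : ln N <= 2 * h.
    rewrite hN lnXn// mulr2n; have := ln_sublinear h0; lra.
  have lnN0 : 0 <= ln N by rewrite ln_ge0// ler1n.
  have n2 : h ^+ 2 <= 2 * n%:R.
    by rewrite -hN /N -natrM ler_nat mul2n -addnn -addn1 leq_add2l.
  have b1 : ln B + kappa * ln N <= `|ln B| + `|kappa| * (2 * h).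
    rewrite lerD ?ler_norm// (le_trans (ler_norm _))// normrM (ger0_norm lnN0).
    by rewrite ler_wpM2l.
  have b2 : D / h * (h ^+ 2 / 2) <= D / h * n%:R.
    rewrite ler_wpM2l//; last by rewrite ler_pdivrMr// mulrC.
    by rewrite divr_ge0 ?(ltW h0)// /D addr_ge0// mulr_ge0.
  apply: (le_trans b1); apply: le_trans b2.
  have -> : D / h * (h ^+ 2 / 2) = `|ln B| * h + `|kappa| * (2 * h).
    by rewrite /D; field; rewrite gt_eqF.
  by rewrite lerD2r ler_peMr.
have C1 : D * Num.sqrt (harmonic n) @[n --> \oo] --> (0 : R).
  have : D * Num.sqrt (harmonic n) @[n --> \oo] --> D * Num.sqrt (0 : R).
    apply: cvgM; first exact: cvg_cst.
    apply: (@cvg_comp _ _ _ harmonic Num.sqrt _ (nbhs (0 : R))); first exact: cvg_harmonic.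
    exact: sqrt_continuous.
  by rewrite sqrtr0 mulr0.
have : theta * expR (D * Num.sqrt (harmonic n)) @[n --> \oo] --> theta * expR 0.
  apply: cvgM; first exact: cvg_cst.
  apply: (@cvg_comp _ _ _ (fun n => D * Num.sqrt (harmonic n)) expR _ (nbhs (0 : R))).
    exact: C1.
  exact: continuous_expR.
by rewrite expR0 mulr1.
Qed.

End root_test.

Theorem theorem4p10 (R : realType) (alpha p q : R)
    (halpha : -1 < alpha) (hp : 1 < p) (hq : 1 < q) :
  let mu := gamma_measure alpha in
  let q' := q / (q - 1) in
  exists C : R, 0 < C /\
  forall (L : nat -> {poly R}) (a : nat -> R) (A0 A : (R -> R) -> R -> R),
    is_laguerre alpha L ->
    (forall n, 0 <= a n) ->
    has_ubound (range a) ->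
    spectral_multiplier alpha L a A0 ->
    bounded_operator mu p q A ->
    extends_to_Lp alpha p A0 A ->
    [/\ (forall tau1 tau2 : R,
          0 < tau1 < 1 / p -> 0 < tau2 < 1 / q' ->
          let pairing :=
            (\int[mu]_x (A (exp_fun tau1) x * exp_fun tau2 x)%:E)%E in
          [/\ exp_fun tau1 \in Lfun mu p%:E,
              mu.-integrable [set: R]
                (fun x => (A (exp_fun tau1) x * exp_fun tau2 x)%:E),
              (pairing =
                ((1 - tau1) `^ (- (alpha + 1))
                  * (1 - tau2) `^ (- (alpha + 1)))%:E
                * ((a 0%N)%:E + \sum_(1 <= n <oo)
                    (a n * (Gamma (n%:R + alpha + 1)
                              / (Gamma (alpha + 1) * n`!%:R))
                      * varrho tau1 tau2 ^+ n)%:E))%E,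
              (pairing < +oo)%E
            & 0 <= varrho tau1 tau2]),
        (limn_esup (fun n => (a n `^ (n%:R)^-1)%:E)
          <= ((p - 1) / (q - 1))%:E)%E
      & (forall n : nat,
          ((a n)%:E <= C%:E * operator_norm mu p q A
             * (((p - 1) / (q - 1)) ^+ n
                 * n.+1%:R `^ ((alpha + 1) * (p^-1 - q^-1) + 1))%:E)%E)].
Proof.
move=> mu q'.
have s0 : 0 < alpha + 1 by rewrite -ltrBlDr sub0r.
have p0 : 0 < p by exact: lt_trans hp.
have pp : 0 < p - 1 by rewrite subr_gt0.
have qp : 0 < q - 1 by rewrite subr_gt0.
have q0 : 0 < q by exact: lt_trans hq.
have q'0 : 0 < q' by rewrite divr_gt0.
have [C C0 HC] := coefficient_constants s0 hp hq.
exists C; split=> // L a A0 A hL a0 _ hA0 hA hext.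
have th0 : 0 < (p - 1) / (q - 1) by rewrite divr_gt0.
have Nfin : operator_norm mu p q A \is a fin_num.
  by rewrite ge0_fin_numE ?(operator_norm_lty hA)// (operator_norm_ge0 _ _ _ (ltW hp)).
(* This real-valued bound yields both the limsup and the last claim; [C] was obtained before the
   multiplier was introduced. *)
have bound n : a n <= C * fine (operator_norm mu p q A) *
    (((p - 1) / (q - 1)) ^+ n * n.+1%:R `^ ((alpha + 1) * (p^-1 - q^-1) + 1)).
  have [t1 [t2 [[t10 pt1] [t20 qt2] H]]] := HC n.
  have := pairing_term_le halpha hL hA0 hp hq hA hext t10 pt1 t20 qt2 a0 n.
  rewrite -(fineK Nfin) -EFinM lee_fin => H1.
  have t11 : t1 < 1 by apply: le_lt_trans pt1; rewrite ler_peMl// ltW.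
  have q'1 : 1 < q' by rewrite ltr_pdivlMr// mul1r gtrBl.
  have t21 : t2 < 1 by apply: le_lt_trans qt2; rewrite ler_peMl// ltW.
  set W := (1 - t1) `^ _ * (1 - t2) `^ _ in H H1.
  set g := Gamma (alpha + 1 + n%:R) / (Gamma (alpha + 1) * n`!%:R) in H.
  have W0 : 0 < W by rewrite mulr_gt0// powR_gt0// subr_gt0.
  have g0 : 0 < g by rewrite divr_gt0 ?mulr_gt0 ?Gamma_gt0 ?ltr0n ?fact_gt0// ltr_wpDr.
  have r0 : 0 < varrho t1 t2 by rewrite divr_gt0 ?mulr_gt0 ?subr_gt0.
  (* The weight of a_n in the pairing, positive and hence cancellable from both sides. *)
  have X0 : 0 < W * (g * varrho t1 t2 ^+ n) 
    by apply: mulr_gt0 => //; apply: mulr_gt0 => //; exact: exprn_gt0.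
  rewrite -(ler_pM2r X0).
  have M0 : 0 <= fine (operator_norm mu p q A).
    by rewrite fine_ge0// (operator_norm_ge0 _ _ _ (ltW hp)).
  have := le_trans H1 (ler_wpM2l M0 H).
  by congr (_ <= _); rewrite /pairing_term -/g; ring.
split.
- move=> tau1 tau2 /andP[t10 tp1] /andP[t20 tq2].
  have pt1 : p * tau1 < 1 by rewrite mulrC -ltr_pdivlMr.
  have qt2 : q' * tau2 < 1 by rewrite mulrC -ltr_pdivlMr.
  have g1p := Lfun_exp_fun halpha p0 pt1.
  have pE := pairingE halpha hL hA0 hp hq hA hext t10 pt1 t20 qt2 a0.
  have pfin := pairing_fin_num halpha hp hq hA pt1 qt2.
  move=> pairing0; split => //.
  + exact: (pairing_integrable halpha hq hA qt2).
  + rewrite /pairing0 -/(pairing alpha A tau2 (exp_fun tau1)) pE; congr (_ * _)%E.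
    exact: (sum_pairing_term halpha hp hq t10 pt1 t20 qt2 a0).
  + by rewrite ltey_eq pfin.
  + exact: (varrho_ge0 hp hq t10 pt1 t20 qt2).
(* Adding 1 keeps [B] positive, so that its logarithm can be used even when the operator norm is
   zero. *)
- pose B := C * (1 + `|fine (operator_norm mu p q A)|).
  have B0 : 0 < B by rewrite mulr_gt0// ltr_pwDl.
  apply: (limn_esup_root_le B0 th0 a0 (kappa := (alpha + 1) * (p^-1 - q^-1) + 1)) => n.
  apply: (le_trans (bound n)).
  apply: ler_wpM2r; first by rewrite mulr_ge0 ?powR_ge0// exprn_ge0// ltW.
  apply: ler_wpM2l; first exact: ltW.
  by rewrite (le_trans (ler_norm _))// lerDr.
- move=> n; rewrite -(fineK Nfin) -!EFinM lee_fin; exact: bound.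
Qed.
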